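(* Let $G$ be a tree with node set $[p]$, and let $\mathcal G$ and $\mathcal H$ be essential graphs with skeleton $G$. Then $\operatorname{conv}(c_{\mathcal G},c_{\mathcal H})$ is an edge (one-dimensional face) of $\operatorname{CIM}_G$ if and only if the pair $\{\mathcal G,\mathcal H\}$ is an essential flip.
   Context: $[p]=\{1,\dots,p\}$. For a directed acyclic graph (DAG) $\mathcal D$ on $[p]$ with parent sets $\mathrm{pa}_{\mathcal D}(i)$, the characteristic imset is the vector $c_{\mathcal D}$ indexed by all $S\subseteq[p]$ with $|S|\ge 2$, where $c_{\mathcal D}(S)=1$ if there is $i\in S$ with $S\setminus\{i\}\subseteq \mathrm{pa}_{\mathcal D}(i)$, and $c_{\mathcal D}(S)=0$ otherwise. The skeleton of a (partially) directed graph is the undirected graph with the same adjacencies. For an undirected graph $G$ on $[p]$, $\operatorname{CIM}_G=\operatorname{conv}(c_{\mathcal D}:\mathcal D \text{ a DAG on }[p]\text{ with skeleton }G)$. A v-structure is an induced subgraph $i\to j\leftarrow k$ (so $i,k$ are non-adjacent). Two DAGs are Markov equivalent if they have the same skeleton and the same v-structures (equivalently, the same characteristic imset); a Markov equivalence class is called an MEC. The essential graph of an MEC is the partially directed graph with the common skeleton, in which an edge is directed $i\to j$ if and only if $i\to j$ in every DAG of the MEC, and is undirected otherwise. For an essential graph $\mathcal G$, $c_{\mathcal G}$ means the characteristic imset of any DAG in its MEC. For a tree $G$ on $[p]$ and $i\in[p]$ let $\mathrm{ne}_G(i)$ be the set of neighbours of $i$ and $N_i=\{S\subseteq[p]: i\in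 S\subseteq \mathrm{ne}_G(i)\cup\{i\},\ |S|\ge 3\}$. For essential graphs $\mathcal G,\mathcal H$ with skeleton $G$ let $\Delta=\Delta(\mathcal G,\mathcal H)=\{i\in[p]: c_{\mathcal G}|_{N_i}\ne c_{\mathcal H}|_{N_i}\}$. For a set of nodes $D$, $\operatorname{span}(D)$ is the unique minimal subtree of $G$ containing $D$, and $\mathcal G|_{A}$ denotes the induced subgraph on the nodes $A$. Essential flip: $\{\mathcal G,\mathcal H\}$ is an essential flip if $\mathcal G,\mathcal H$ are essential graphs with skeleton the tree $G$ that are not Markov equivalent, $\mathcal G|_{\operatorname{span}(\Delta)}$ and $\mathcal H|_{\operatorname{span}(\Delta)}$ contain no undirected edges, and every edge of $G|_{\operatorname{span}(\Delta)}$ is directed differently in $\mathcal G$ and $\mathcal H$. *)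

(* Defs.v *)
From HB Require Import structures.
From mathcomp Require Import all_boot all_order all_algebra.
Set Implicit Arguments.
Unset Strict Implicit.
Unset Printing Implicit Defensive.
Import Order.TTheory GRing.Theory Num.Theory.
Local Open Scope ring_scope.

Section Graphs.
Variable T : finType.
Implicit Types (G : rel T) (A N : {set T}).

Definition induced G A : rel T := [rel x y | [&& x \in A, y \in A & G x y]].

(* Undirected graphs are symmetric irreflexive relations. *)
Definition is_tree G : Prop :=
  [/\ (0 < #|T|)%N, symmetric G, irreflexive G,
      forall x y, connect G x y
    & forall s : seq T, (2 < size s)%N -> ~ ucycle G s].

(* Node sets of the subtrees of a tree G.  A connected subgraph of a tree
   contains every edge of G between its nodes, so it is given by its nodes. *)
Definition subtree G A : bool :=
  [forall x in A, forall y in A, connect (induced G A) x y].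

(* The default value set0 is never used when G is connected. *)
Definition span G N : {set T} :=
  odflt set0 [pick A | minset (fun B => subtree G B && (N \subset B)) A].

Definition neighbours G (i : T) : {set T} := [set j | G i j].

(* A directed graph is its set of arrows: (i, j) \in D means i -> j. *)
Definition digraph := {set T * T}.
Implicit Types D E : digraph.

Definition arrow D : rel T := [rel i j | (i, j) \in D].

(* There is no arrow x -> y with a directed path from y back to x. *)
Definition is_dag D : bool :=
  [forall x, forall y, arrow D x y ==> ~~ connect (arrow D) y x].

Definition parents D (i : T) : {set T} := [set j | arrow D j i].

Definition skeleton D : rel T := [rel i j | arrow D i j || arrow D j i].

Definition v_structure D (i j k : T) : bool :=
  [&& arrow D i j, arrow D k j, i != k & ~~ skeleton D i k].

Definition markov_equiv D E : bool :=
  [forall i, forall j, skeleton D i j == skeleton E i j] &&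
  [forall i, forall j, forall k, v_structure D i j k == v_structure E i j k].

(* A partially directed graph is the pair of its set of arrows and its set of
   undirected edges, an undirected edge being stored in both orientations. *)
Definition pdgraph := ({set T * T} * {set T * T})%type.
Implicit Types g h : pdgraph.

Definition pd_arrow g : rel T := [rel i j | (i, j) \in g.1].
Definition pd_line g : rel T := [rel i j | (i, j) \in g.2].

Definition pd_skeleton g : rel T :=
  [rel i j | [|| pd_arrow g i j, pd_arrow g j i | pd_line g i j]].

Definition pd_induced g A : pdgraph :=
  ([set e in g.1 | (e.1 \in A) && (e.2 \in A)],
   [set e in g.2 | (e.1 \in A) && (e.2 \in A)]).

(* The arrows common to all the DAGs Markov equivalent to D. *)
Definition compelled D : {set T * T} :=
  [set e | [forall E : digraph, (is_dag E && markov_equiv D E) ==> (e \in E)]].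

Definition essential_graph_of D : pdgraph :=
  (compelled D,
   [set e | [&& skeleton D e.1 e.2, (e.1, e.2) \notin compelled D
              & (e.2, e.1) \notin compelled D]]).

(* D belongs to the Markov equivalence class with essential graph g. *)
Definition in_mec g D : bool := is_dag D && (essential_graph_of D == g).

Definition is_essential g : Prop := exists D, in_mec g D.

Definition imset_index := {S : {set T} | (1 < #|S|)%N}.

Definition char_imset D : {ffun imset_index -> bool} :=
  [ffun S : imset_index =>
     [exists i in val S, val S :\ i \subset parents D i]].

(* The characteristic imset of some DAG of the class: Markov equivalent DAGs
   have the same characteristic imset.  The default value is only used when g
   is not an essential graph. *)
Definition ess_imset g : {ffun imset_index -> bool} :=
  if [pick D : digraph | in_mec g D] is Some D then char_imset D
  else [ffun => false].

Definition star_family G (i : T) : {set {set T}} :=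
  [set S : {set T} | [&& i \in S, S \subset i |: neighbours G i & (3 <= #|S|)%N]].

Definition Delta G g h : {set T} :=
  [set i | [exists S : imset_index,
     (val S \in star_family G i) && (ess_imset g S != ess_imset h S)]].

Definition essential_flip G g h : Prop :=
  let A := span G (Delta G g h) in
  [/\ (is_essential g /\ pd_skeleton g =2 G) /\
        (is_essential h /\ pd_skeleton h =2 G),
      forall D E, in_mec g D -> in_mec h E -> ~~ markov_equiv D E,
      (pd_induced g A).2 = set0 /\ (pd_induced h A).2 = set0
    & forall x y, induced G A x y ->
        (pd_arrow g x y /\ pd_arrow h y x) \/
        (pd_arrow g y x /\ pd_arrow h x y)].

End Graphs.

Section Polytopes.
Variables (R : realFieldType) (V : vectType R).
Implicit Types (P F : V -> Prop).

Definition conv_hull P (x : V) : Prop :=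
  exists n (v : 'I_n -> V) (a : 'I_n -> R),
    [/\ forall i, P (v i), forall i, 0 <= a i, \sum_i a i = 1
      & x = \sum_i a i *: v i].

Definition is_face P F : Prop :=
  exists (f : {linear V -> R^o}) (b : R),
    (forall x, P x -> f x <= b) /\ (forall x, F x <-> P x /\ f x = b).

(* U is the direction space of the affine hull of F. *)
Definition has_dim F (d : nat) : Prop :=
  exists (x0 : V) (U : {vspace V}),
    [/\ F x0, forall x, F x -> x - x0 \in U,
        forall W : {vspace V}, (forall x, F x -> x - x0 \in W) -> (U <= W)%VS
      & \dim U = d].

Definition is_edge P F : Prop := is_face P F /\ has_dim F 1.

End Polytopes.

Definition imset_space (R : realFieldType) (T : finType) :=
  {ffun imset_index T -> R^o}.

Definition imset_vec (R : realFieldType) (T : finType)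
    (c : {ffun imset_index T -> bool}) : imset_space R T :=
  [ffun S => (c S)%:R].

Definition CIM (R : realFieldType) (T : finType) (G : rel T) :
    imset_space R T -> Prop :=
  conv_hull (fun x : imset_space R T => exists D : digraph T,
    [/\ is_dag D, skeleton D =2 G & x = imset_vec R (char_imset D)]).

Definition segment (R : realFieldType) (V : vectType R) (x y : V) : V -> Prop :=
  conv_hull (fun z => z = x \/ z = y).

(* Main.v *)
(* For a tree every orientation is acyclic, and the characteristic imset of an
   orientation D amounts to the sets vpar D i, where vpar D i is the parent set
   of i if it has at least two elements and is empty otherwise.

   If D and E orient an edge of span(Delta) in the same way, then exchanging
   the two sides of this edge gives orientations U and V with
   c_U + c_V = c_D + c_E, and c_U is not on the segment since Delta meets both
   sides: the segment is not a face.

   Conversely any sum over the nodes i of a function of vpar D i is affine in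
   c_D.  For an essential flip (D, E), charge every node with the inflow minus
   the outflow of a weight lam on the arrows of D in A = span(Delta), to be
   collected when vpar F i = vpar D i; values of vpar F i other than those of D
   and E get a large penalty.  The total vanishes at D and at E, and adding the
   flow of the arrows of D present in F, whose total is zero, shows that it is
   minus a sum of local excesses.  The weight lam, negative along the chains of
   nodes with a single parent and growing along them, makes the excesses
   nonnegative, and positive unless F agrees around i with D or with E;
   connectedness of A makes this choice uniform. *)
Require Import Defs.
From HB Require Import structures.
From mathcomp Require Import all_boot all_order all_algebra.
From mathcomp Require Import lra.
Set Implicit Arguments.
Unset Strict Implicit.
Unset Printing Implicit Defensive.
Import Order.TTheory GRing.Theory Num.Theory.

(** * Trees and the two sides of an edge *)

Section Tree.
Variables (T : finType) (G : rel T).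
Hypothesis treeG : is_tree G.
Implicit Types (A B C : {set T}) (x y z i j k : T).

Lemma tree_sym : symmetric G. Proof. by case: treeG. Qed.

Lemma tree_irr x : G x x = false. Proof. by case: treeG => _ _ ->. Qed.

Lemma tree_connect x y : connect G x y. Proof. by case: treeG. Qed.

Lemma tree_acyclic (s : seq T) : 2 < size s -> ~ ucycle G s.
Proof. by case: treeG => _ _ _ _; apply. Qed.

Lemma tree_no_triangle x y z : G x y -> G y z -> G z x -> False.
Proof.
move=> xy yz zx; apply: (@tree_acyclic [:: x; y; z]) => //.
apply/andP; split; first by rewrite /= xy yz zx.
have ne u v : G u v -> u != v by move=> uv; apply/eqP=> E; rewrite E tree_irr in uv.
by rewrite /= !inE negb_or (ne _ _ xy) (ne _ _ yz) eq_sym (ne _ _ zx).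
Qed.

Definition del_edge x y : rel T :=
  [rel u v | [&& G u v, (u, v) != (x, y) & (u, v) != (y, x)]].

Definition cut x y : {set T} := [set i | connect (del_edge x y) x i].

Lemma cut_self x y : x \in cut x y. Proof. by rewrite inE connect0. Qed.

(** A simple path from [x] to [y] that avoids the edge between them has at least three nodes, and
    this edge closes it to a cycle. *)
Lemma cut_other x y : G x y -> y \notin cut x y.
Proof.
move=> xy; apply/negP; rewrite inE => /connectP[p]; move=> xp yE.
case/shortenP: xp yE => p' xp' Up' _ yE.
have xp'G : path G x p' by apply: sub_path xp' => u v /and3P[].
case: p' => [|z [|t p']] in xp' Up' yE xp'G *.
- by rewrite yE /= tree_irr in xy.
- by rewrite /= in yE; case/andP: xp' => /and3P[_ /eqP]; rewrite yE.
apply: (@tree_acyclic (x :: z :: t :: p')) => //.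
apply/andP; split => //.
by rewrite /cycle rcons_path xp'G -yE tree_sym.
Qed.

Lemma cut_cross x y i j :
  G x y -> i \in cut x y -> j \notin cut x y -> G i j -> i = x /\ j = y.
Proof.
move=> xy iC jC ij.
have [/eqP[-> ->//]|nxy] := boolP ((i, j) == (x, y)).
have [/eqP[iy _]|nyx] := boolP ((i, j) == (y, x)).
  by rewrite iy (negPf (cut_other xy)) in iC.
case/negP: jC; rewrite !inE in iC *; apply: connect_trans iC (connect1 _).
exact/and3P.
Qed.

Lemma connect_preserves (r : rel T) (a : pred T) x y :
  (forall u v, r u v -> a u -> a v) -> connect r x y -> a x -> a y.
Proof.
move=> cl /connectP[p + ->]; elim: p x => //= z p IH x /andP[xz zp] ax.
exact: IH zp (cl _ _ xz ax).
Qed.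

(** A walk from [y] could enter [cut x y] only through the edge between [x] and [y], which is
    deleted. *)
Lemma cut_disjoint x y j : G x y -> j \in cut y x -> j \notin cut x y.
Proof.
move=> xy; rewrite inE => yj; have GC := tree_sym.
apply: (@connect_preserves _ [predC cut x y] _ _ _ yj); last exact: cut_other.
move=> u v /and3P[uv nyx _] /= uC; apply/negP=> vC; rewrite GC in uv.
by have [vx uy] := cut_cross xy vC uC uv; rewrite vx uy eqxx in nyx.
Qed.

Lemma connect_first (r : rel T) x y : connect r x y -> x != y -> exists z, r x z.
Proof.
case/connectP=> [[|z p]] /= => [_ -> /eqP//|/andP[xz _] _ _]; by exists z.
Qed.

(** * Subtrees and spans *)

Lemma subtreeP A :
  reflect {in A &, forall x y, connect (induced G A) x y} (subtree G A).
Proof.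
apply: (iffP idP) => [/forall_inP H x y xA yA | H].
  exact: (forall_inP (H x xA)).
by apply/forall_inP=> x xA; apply/forall_inP=> y yA; apply: H.
Qed.

(* Contract the removed side onto the endpoint that is kept. *)
Lemma subtree_cut A x y : subtree G A -> x \in A -> y \in A -> G x y ->
  subtree G (A :\: cut x y).
Proof.
move=> /subtreeP cA xA yA xy; apply/subtreeP=> u v.
rewrite !inE => /andP[uC uA] /andP[vC vA].
pose rho i := if i \in cut x y then y else i.
have step i j : induced G A i j -> connect (induced G (A :\: cut x y)) (rho i) (rho j).
  case/and3P=> iA jA ij; rewrite /rho; case: ifPn => iC; case: ifPn => jC //.
  - by have [_ ->] := cut_cross xy iC jC ij; apply: connect0.
  - by rewrite tree_sym in ij; have [_ ->] := cut_cross xy jC iC ij; apply: connect0.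
  by by apply: connect1; apply/and3P; rewrite !in_setD iC jC.
have: connect (induced G (A :\: cut x y)) (rho u) (rho v).
  have /connectP[p up ->] := cA _ _ uA vA.
  elim: p u up {uC uA vC vA} => [|w p IH] u /=; first by rewrite connect0.
  by case/andP=> /step uw /IH; apply: connect_trans.
by rewrite /rho !inE (negPf uC) (negPf vC).
Qed.

Section Span.
Variable N : {set T}.

(** Since [G] is connected, the whole node set is a candidate, so the [pick] in [span] succeeds. *)
Lemma span_minset : minset (fun B => subtree G B && (N \subset B)) (Defs.span G N).
Proof.
rewrite /Defs.span; case: pickP => [//|none].
have [] := @minset_exists _ (fun B => subtree G B && (N \subset B)) [set: T].
  rewrite subsetT andbT; apply/subtreeP=> x y _ _.
  apply: connect_sub (tree_connect x y) => u v uv.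
  by apply: connect1; apply/and3P; rewrite !inE.
by move=> A mA _; rewrite none in mA.
Qed.

Lemma span_subtree : subtree G (Defs.span G N).
Proof. by have /minsetP[/andP[]] := span_minset. Qed.

Lemma sub_tree_span : N \subset Defs.span G N.
Proof. by have /minsetP[/andP[]] := span_minset. Qed.

(** By minimality of the span: a side free of [N] could be cut off by [subtree_cut], although it
    contains [x]. *)
Lemma span_cut x y : x \in Defs.span G N -> y \in Defs.span G N -> G x y ->
  exists2 i, i \in N & i \in cut x y.
Proof.
move=> xA yA xy; apply/exists_inP; apply: contraT => /exists_inPn none.
have /minsetP[_ min] := span_minset.
have AE : Defs.span G N :\: cut x y = Defs.span G N.
  apply: min; last exact: subsetDl.
  rewrite (subtree_cut span_subtree) //= subsetD sub_tree_span /=.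
  by apply/pred0P=> i /=; apply/negP=> /andP[iN]; apply/negP/none.
by have := xA; rewrite -AE inE cut_self.
Qed.

(** Leaves of the span lie in [N]: if [a] were the only neighbour of [i] in the span, then
    [span_cut] would give an element of [N] on the side of [i], where the span has no node but
    [i]. *)
Lemma span_inner i : N != set0 -> i \in Defs.span G N -> i \notin N ->
  exists a b, [/\ a \in Defs.span G N, b \in Defs.span G N, G i a, G i b & a != b].
Proof.
case/set0Pn=> n nN iA iN.
have nA : n \in Defs.span G N by apply: (subsetP sub_tree_span).
have in_ : i != n by apply: contraNneq iN => ->.
have [a /and3P[_ aA ia]] := connect_first (subtreeP _ span_subtree _ _ iA nA) in_.
have [b /and3P[bA ib ab]|none] :=
  pickP [pred b | [&& b \in Defs.span G N, G i b & a != b]].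
  by exists a, b.
have [m mN mC] := span_cut iA aA ia.
have mA : m \in Defs.span G N by apply: (subsetP sub_tree_span).
(* A walk inside the span that starts at [a] can reach the side of [i] only at [i], and can leave
   [i] only to [a]. *)
have: (m \notin cut i a) || (m == i).
  have cam := subtreeP _ span_subtree _ _ aA mA.
  apply: (@connect_preserves _ [pred k | (k \notin cut i a) || (k == i)] _ _ _ cam); last first.
    by rewrite /= cut_other.
  move=> u v /and3P[uA vA uv] /=; have [ui|ni] := eqVneq u i.
    rewrite ui in uv => _; case: (eqVneq v a) => [->|va]; first by rewrite cut_other.
    by have := none v; rewrite /= vA uv eq_sym va.
  rewrite orbF => uC; case: (boolP (v \in cut i a)) => //= vC.
  rewrite tree_sym in uv; have [-> _] := cut_cross ia vC uC uv; exact: eqxx.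
rewrite mC /= => /eqP mi; by rewrite mi (negPf iN) in mN.
Qed.

End Span.

(** * Orientations of the tree and their parent sets *)

Implicit Types (g h : pdgraph T) (D E : digraph T) (S : imset_index T) (Q : {set T}).

(** By [dag_orients], [orients_skeleton] and [orients_dag], these are exactly the DAGs with skeleton
    [G]. *)
Definition orients D : Prop :=
  (forall i j, (i, j) \in D -> G i j) /\
  (forall i j, G i j -> ((i, j) \in D) = ((j, i) \notin D)).

Lemma dag_orients D : is_dag D -> skeleton D =2 G -> orients D.
Proof.
move=> /forallP dagD skD; split=> [i j ij | i j].
  by rewrite -skD /skeleton /arrow /= ij.
rewrite -skD => /orP[]; rewrite /arrow /= => ij; rewrite ij.
  apply/esym/negP=> ji; have /forallP/(_ j)/implyP/(_ ij)/negP := dagD i.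
  by apply; apply: connect1.
apply/negP=> ji; have /forallP/(_ i)/implyP/(_ ij)/negP := dagD j.
by apply; apply: connect1.
Qed.

Lemma orients_skeleton D : orients D -> skeleton D =2 G.
Proof.
case=> sub tot i j; rewrite /skeleton /arrow /=; apply/idP/idP => [|ij].
  by case/orP => [/sub//|/sub]; rewrite tree_sym.
by rewrite (tot _ _ ij) orNb.
Qed.

(** A directed path from [y] back to [x] is either the reversed arrow, excluded by [orients], or
    closes up with [x -> y] to a cycle of [G]. *)
Lemma orients_dag D : orients D -> is_dag D.
Proof.
case=> sub tot; apply/forallP=> x; apply/forallP=> y; apply/implyP=> xy.
apply/negP=> /connectP[p yp xE]; case/shortenP: yp xE => q yq Uq _ xE.
have xyG := sub _ _ xy.
have yqG : path G y q by apply: sub_path yq => u v /sub.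
case: q => [|z [|t q]] in yq Uq xE yqG *.
- by rewrite xE /= tree_irr in xyG.
- rewrite /= in xE; case/andP: yq => + _; rewrite -xE.
  by rewrite /= /arrow /=; apply/negP; rewrite -tot.
apply: (@tree_acyclic (y :: z :: t :: q)) => //.
apply/andP; split => //.
by rewrite /cycle rcons_path yqG -xE.
Qed.

Lemma in_parents D i j : (j \in parents D i) = ((j, i) \in D).
Proof. by rewrite inE. Qed.

Lemma orients_antisym D i j : orients D -> (i, j) \in D -> (j, i) \notin D.
Proof. by case=> sub tot ij; rewrite -(tot i j) ?(sub _ _ ij). Qed.

(* In a tree two parents of a node are never adjacent, so the v-structures at i
   are the pairs of elements of vpar D i. *)
Definition vpar D i := if 1 < #|parents D i| then parents D i else set0.

Lemma sub_vpar D i Q : 1 < #|Q| -> (Q \subset vpar D i) = (Q \subset parents D i).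
Proof.
rewrite /vpar => Q2; case: ifP => // npar; rewrite subset0.
apply/eqP/idP => [Q0 | /subset_leq_card]; first by rewrite Q0 cards0 in Q2.
by move=> le; rewrite (leq_trans Q2 le) in npar.
Qed.

Lemma vpar_parents D i : vpar D i != set0 -> vpar D i = parents D i.
Proof. by rewrite /vpar; case: ifP => //; rewrite eqxx. Qed.

Lemma vpar0 D i : vpar D i = set0 -> #|parents D i| <= 1.
Proof.
rewrite /vpar; case: ltnP => // lt par0; by rewrite par0 cards0 in lt.
Qed.

(** A parent set with at least two elements is itself one of the test sets [Q], so it is contained
    in the other parent set. *)
Lemma vpar_eqP D E i :
  (forall Q, 1 < #|Q| -> Q \subset neighbours G i ->
     (Q \subset parents D i) = (Q \subset parents E i)) ->
  orients D -> orients E -> vpar D i = vpar E i.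
Proof.
move=> eqQ oD oE.
have nb F : orients F -> parents F i \subset neighbours G i.
  by case=> sub _; apply/subsetP=> j; rewrite in_parents inE tree_sym => /sub.
rewrite /vpar; case: ltnP => cD; case: ltnP => cE //; last first.
- have := eqQ _ cE (nb _ oE); rewrite subxx => /subset_leq_card le.
  by have := leq_trans cE (leq_trans le cD).
- have := eqQ _ cD (nb _ oD); rewrite subxx => /esym/subset_leq_card le.
  by have := leq_trans cD (leq_trans le cE).
apply/eqP; rewrite eqEsubset (eqQ _ cE (nb _ oE)) -(eqQ _ cD (nb _ oD)).
by rewrite !subxx.
Qed.

(** * Characteristic imsets, v-structures and parent sets *)

Lemma card_pair Q i : #|Q| = 2 -> i \in Q -> exists2 j, j != i & Q :\ i = [set j].
Proof.
move=> Q2 iQ; have /cards1P[j jE] : #|Q :\ i| == 1.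
  by have := cardsD1 i Q; rewrite Q2 iQ => /eqP; rewrite eqSS eq_sym.
exists j => //; have : j \in Q :\ i by rewrite jE set11.
by case/setD1P.
Qed.

Lemma imset_pair D S : orients D -> #|val S| = 2 ->
  char_imset D S = [exists i in val S, val S :\ i \subset neighbours G i].
Proof.
move=> [sub tot] S2; rewrite ffunE; apply/exists_inP/exists_inP => -[i iS].
  case: (card_pair S2 iS) => j ji SE; rewrite SE sub1set inE => /sub ij.
  by exists i; rewrite // SE sub1set inE tree_sym.
have [j ji SE] := card_pair S2 iS; rewrite SE sub1set inE => ij.
have jS : j \in val S by have := set11 j; rewrite -SE => /setD1P[].
have [ijD|nijD] := boolP ((i, j) \in D); last first.
  by exists i; rewrite // SE sub1set inE /= /arrow /= tot // tree_sym.
exists j => //; have [k kj SE'] := card_pair S2 jS.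
suff -> : val S :\ j = [set i] by rewrite sub1set inE.
have : i \in val S :\ j by rewrite !inE eq_sym ji.
by rewrite SE' inE => /eqP->.
Qed.

(** If another node [k] of [S] had the rest of [S] as parents, then [i], [k] and a third element of
    [S] would form a triangle. *)
Lemma imset_star D S i : orients D -> 2 < #|val S| -> i \in val S ->
  val S :\ i \subset neighbours G i ->
  char_imset D S = (val S :\ i \subset parents D i).
Proof.
move=> [sub tot] S3 iS nbS; rewrite ffunE.
apply/exists_inP/idP => [[k kS parS] | parS]; last by exists i.
have [<-//|ki] := eqVneq k i.
have: 0 < #|val S :\ i :\ k|.
  move: S3; rewrite (cardsD1 i) iS (cardsD1 k (val S :\ i)) !inE ki kS.
  by case: #|_|.
rewrite card_gt0 => /set0Pn[j]; rewrite !inE => /and3P[jk ji jS].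
case: (@tree_no_triangle i k j).
- by have /(subsetP nbS) : k \in val S :\ i; rewrite !inE // ki kS.
- have /(subsetP parS) : j \in val S :\ k by rewrite !inE jk jS.
  by rewrite inE tree_sym => /sub.
have /(subsetP nbS) : j \in val S :\ i by rewrite !inE ji jS.
by rewrite inE tree_sym.
Qed.

(* It is constant for #|S| = 2, and for #|S| > 2 only the centre i of the star
   S can have its other elements as parents. *)
Lemma imset_local S : exists i (b : pred {set T}),
  (forall Q Q', (forall Q0, 1 < #|Q0| -> (Q0 \subset Q) = (Q0 \subset Q')) ->
     b Q = b Q') /\
  forall D, orients D -> char_imset D S = b (parents D i).
Proof.
have [S2|S2] := eqVneq #|val S| 2.
  have /set0Pn[i _] : val S != set0 by rewrite -card_gt0 S2.
  exists i, (fun=> [exists i in val S, val S :\ i \subset neighbours G i]).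
  by split=> // D oD; rewrite (imset_pair oD S2).
have S3 : 2 < #|val S| by rewrite ltn_neqAle eq_sym S2 (valP S).
have [/exists_inP[i iS nbS]|/exists_inPn none] :=
  boolP [exists i in val S, val S :\ i \subset neighbours G i].
  exists i, (fun Q => val S :\ i \subset Q); split=> [Q Q' eqQ|D oD].
    by apply: eqQ; move: S3; rewrite (cardsD1 i) iS.
  exact: imset_star.
have /set0Pn[i _] : val S != set0 by rewrite -card_gt0 (ltn_trans _ S3).
exists i, xpred0; split=> // D [sub _]; rewrite ffunE; apply/exists_inP => -[k kS parS].
case/negP: (none k kS); apply: subset_trans parS _.
by apply/subsetP=> j; rewrite !inE tree_sym => /sub.
Qed.

Lemma vpar_imset D E : orients D -> orients E ->
  (forall i, vpar D i = vpar E i) -> char_imset D = char_imset E.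
Proof.
move=> oD oE eqv; apply/ffunP=> S; have [i [b [bext bE]]] := imset_local S.
rewrite !bE //; apply: bext => Q Q2.
by rewrite -(sub_vpar D) // -(sub_vpar E) // eqv.
Qed.

(** For a set [Q] of at least two neighbours of [i], the coordinate at [i |: Q] tells whether [Q]
    consists of parents of [i]. *)
Lemma imset_vpar D E i : orients D -> orients E ->
  (forall S, val S \in star_family G i -> char_imset D S = char_imset E S) ->
  vpar D i = vpar E i.
Proof.
move=> oD oE eqS; apply: vpar_eqP => // Q Q2 Qnb.
have iQ : i \notin Q by apply/negP=> /(subsetP Qnb); rewrite inE tree_irr.
have cS : 2 < #|i |: Q| by rewrite cardsU1 iQ.
have S2 : 1 < #|i |: Q| by apply: ltn_trans cS.
have SE : (i |: Q) :\ i = Q by rewrite setU1K.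
pose S : imset_index T := Sub (i |: Q) S2.
have := eqS S; rewrite (@imset_star D S i) //= ?(@imset_star E S i) //= ?setU11 ?SE //.
by apply; rewrite inE setU11 setUS //=.
Qed.

Lemma star_vpar D E i S : orients D -> orients E -> vpar D i = vpar E i ->
  val S \in star_family G i -> char_imset D S = char_imset E S.
Proof.
move=> oD oE eqv; rewrite inE => /and3P[iS nbS S3].
have S2 : 1 < #|val S :\ i| by move: S3; rewrite (cardsD1 i) iS.
have nb : val S :\ i \subset neighbours G i by rewrite subDset.
by rewrite !(@imset_star _ S i) // -!sub_vpar // eqv.
Qed.

Lemma v_structureE D i j k : orients D ->
  v_structure D i j k = [&& i != k, i \in vpar D j & k \in vpar D j].
Proof.
move=> oD; have [sub tot] := oD; rewrite /v_structure (orients_skeleton oD).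
have vparE a b : a != b -> (a \in vpar D j) && (b \in vpar D j) =
    (a \in parents D j) && (b \in parents D j).
  move=> ab; have := @sub_vpar D j [set a; b].
  by rewrite cards2 ab !subUset !sub1set; apply.
have [->|ik] /= := eqVneq i k; first by rewrite !andbF.
rewrite (vparE _ _ ik) !in_parents /arrow /= andbA andb_idr // => /andP[ij kj].
apply/negP=> Gik; apply: (@tree_no_triangle i k j) => //; first exact: sub.
by rewrite tree_sym; apply: sub.
Qed.

(** In a set of at least two parents of [j], each element forms a v-structure at [j] with another
    one, so it is still a parent of [j] in any graph with the same v-structures. *)
Lemma markov_vpar D E : orients D -> orients E ->
  markov_equiv D E <-> forall i, vpar D i = vpar E i.
Proof.
move=> oD oE; split=> [/andP[_ /forallP vD] j | eqv].
  have imp F H Q : orients F -> orients H ->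
      (forall i k, v_structure F i j k = v_structure H i j k) ->
      1 < #|Q| -> Q \subset parents F j -> Q \subset parents H j.
    move=> oF oH vFH Q2 QF; apply/subsetP=> a aQ.
    have /set0Pn[b] : Q :\ a != set0.
      by rewrite -card_gt0; move: Q2; rewrite (cardsD1 a) aQ.
    rewrite !inE => /andP[ba bQ]; have QFv : Q \subset vpar F j by rewrite sub_vpar.
    have : v_structure F a j b by rewrite v_structureE // eq_sym ba !(subsetP QFv).
    by rewrite vFH => /and3P[].
  have vDE i k : v_structure D i j k = v_structure E i j k.
    by have /forallP/(_ j)/forallP/(_ k)/eqP := vD i.
  by apply: vpar_eqP => // Q Q2 _; apply/idP/idP; apply: imp.
apply/andP; split.
  by apply/forallP=> i; apply/forallP=> j; rewrite !orients_skeleton.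
by do 3 apply/forallP=> ?; rewrite !v_structureE // eqv.
Qed.

(** * Exchanging parent sets across a cut *)

Definition of_parents (pa : T -> {set T}) : digraph T := [set e | e.1 \in pa e.2].

Lemma parents_of pa i : parents (of_parents pa) i = pa i.
Proof. by apply/setP=> j; rewrite in_parents inE. Qed.

(** For [C] one side of an edge that [D] and [E] orient alike, [mix C D E] and [mix C E D] are the
    two orientations obtained by exchanging sides. *)
Definition mix C D E : digraph T :=
  of_parents (fun i => if i \in C then parents D i else parents E i).

Lemma parents_mix C D E i :
  parents (mix C D E) i = if i \in C then parents D i else parents E i.
Proof. exact: parents_of. Qed.

Lemma orients_mix C D E : orients D -> orients E ->
  (forall i j, i \in C -> j \notin C -> G i j -> ((i, j) \in D) = ((i, j) \in E)) ->
  orients (mix C D E).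
Proof.
move=> [sD tD] [sE tE] cross; split=> i j.
  by rewrite inE /=; case: ifP; rewrite in_parents => _; [apply: sD | apply: sE].
move=> ij; rewrite !inE /=; case: ifPn => jC; case: ifPn => iC; rewrite !in_parents.
- exact: tD.
- by rewrite (tD _ _ ij) (cross j i) // tree_sym.
- by rewrite -(cross i j) //; apply: tD.
- exact: tE.
Qed.

(** A coordinate reads the parents of a single node, and each of the two mixes takes these from a
    different one of [D] and [E]. Hence the two imsets keep their sum. *)
Lemma mix_imset C D E S : orients D -> orients E ->
  (forall i j, i \in C -> j \notin C -> G i j -> ((i, j) \in D) = ((i, j) \in E)) ->
  (char_imset (mix C D E) S = char_imset D S /\
   char_imset (mix C E D) S = char_imset E S) \/
  (char_imset (mix C D E) S = char_imset E S /\
   char_imset (mix C E D) S = char_imset D S).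
Proof.
move=> oD oE cross.
have [i [b [_ bE]]] := imset_local S.
have oDE : orients (mix C D E) by apply: orients_mix.
have oED : orients (mix C E D) by apply: orients_mix => // i' j *; rewrite cross.
by rewrite !bE // !parents_mix; case: ifP; [left | right].
Qed.

(** * Markov equivalence classes and essential graphs *)

Lemma markov_refl D : markov_equiv D D.
Proof.
by apply/andP; split; do 2 apply/forallP=> ?; [ | apply/forallP=> ?].
Qed.

Lemma markov_sym D E : markov_equiv D E = markov_equiv E D.
Proof.
by congr (_ && _); do 2 apply: eq_forallb => ?; [ | apply: eq_forallb => ?]; rewrite eq_sym.
Qed.

Lemma markov_trans D E F : markov_equiv D E -> markov_equiv E F -> markov_equiv D F.
Proof.
move=> /andP[/'forall_'forall_eqP s1 /'forall_'forall_'forall_eqP v1].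
move=> /andP[/'forall_'forall_eqP s2 /'forall_'forall_'forall_eqP v2].
apply/andP; split; first by apply/'forall_'forall_eqP=> i j; rewrite s1.
by apply/'forall_'forall_'forall_eqP=> i j k; rewrite v1.
Qed.

Lemma compelledP D i j :
  reflect (forall E, is_dag E -> markov_equiv D E -> (i, j) \in E)
          ((i, j) \in compelled D).
Proof.
rewrite inE; apply: (iffP forallP) => [H E dE DE | H E].
  by have := H E; rewrite dE DE.
by apply/implyP=> /andP[]; apply: H.
Qed.

Lemma compelled_sub D i j : is_dag D -> (i, j) \in compelled D -> (i, j) \in D.
Proof. by move=> dD /compelledP; apply=> //; apply: markov_refl. Qed.

Lemma markov_compelled D E : markov_equiv D E -> compelled D = compelled E.
Proof.
move=> DE; apply/setP=> -[i j]; apply/compelledP/compelledP => H F dF.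
  by move=> EF; apply: H => //; apply: markov_trans EF.
by move=> DF; apply: H => //; apply: markov_trans DF; rewrite markov_sym.
Qed.

Lemma markov_essential D E : markov_equiv D E -> essential_graph_of D = essential_graph_of E.
Proof.
move=> DE; rewrite /essential_graph_of (markov_compelled DE); congr (_, _).
apply/setP=> -[i j]; rewrite !inE /=; congr (_ && _).
by case/andP: DE => /'forall_'forall_eqP.
Qed.

Lemma mec_dag g D : in_mec g D -> is_dag D. Proof. by case/andP. Qed.

Lemma mec_arrow g D : in_mec g D -> pd_arrow g =2 [rel i j | (i, j) \in compelled D].
Proof. by case/andP=> _ /eqP<-. Qed.

Lemma mec_orients g D : pd_skeleton g =2 G -> in_mec g D -> orients D.
Proof.
move=> skg gD; have dD := mec_dag gD; apply: dag_orients => // i j; rewrite -skg.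
have arrE a b : pd_arrow g a b = ((a, b) \in compelled D) by rewrite (mec_arrow gD).
rewrite /pd_skeleton /= !arrE.
have -> : pd_line g i j = [&& skeleton D i j, (i, j) \notin compelled D
    & (j, i) \notin compelled D] by case/andP: gD => _ /eqP<-; rewrite [LHS]inE.
have [/(compelled_sub dD) ij|_] := boolP ((i, j) \in compelled D).
  by rewrite /skeleton /arrow /= ij.
have [/(compelled_sub dD) ji|_] := boolP ((j, i) \in compelled D).
  by rewrite /skeleton /arrow /= ji orbT.
by rewrite !andbT.
Qed.

(** Membership in a class is defined by the essential graph. The v-structures can be read off it
    because their arrows are compelled. *)
Lemma mec_markov g D E : pd_skeleton g =2 G -> in_mec g D -> in_mec g E -> markov_equiv D E.
Proof.
move=> skg gD gE; have oD := mec_orients skg gD; have oE := mec_orients skg gE.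
have cDE : compelled D = compelled E.
  by case/andP: gD => _ /eqP gD; case/andP: gE => _ /eqP; rewrite -gD => -[-> _].
have imp F H i j k : in_mec g F -> in_mec g H -> compelled F = compelled H ->
    v_structure F i j k -> v_structure H i j k.
  move=> gF gH cFH vF; have oF := mec_orients skg gF; have oH := mec_orients skg gH.
  have /and4P[ij kj ik nik] := vF; rewrite /v_structure ik.
  rewrite (orients_skeleton oH) -(orients_skeleton oF) nik /=.
  apply/and3P; split=> //; apply: (compelled_sub (mec_dag gH)); rewrite -cFH.
    apply/compelledP=> F' _ /andP[_ /'forall_'forall_'forall_eqP v].
    by move: vF; rewrite v => /and4P[].
  apply/compelledP=> F' _ /andP[_ /'forall_'forall_'forall_eqP v].
  by move: vF; rewrite v => /and4P[].
apply/andP; split; apply/forallP=> i; apply/forallP=> j.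
  by rewrite !orients_skeleton.
by apply/forallP=> k; apply/eqP; apply/idP/idP; apply: imp.
Qed.

Lemma markov_mec g D E : in_mec g D -> is_dag E -> markov_equiv D E -> in_mec g E.
Proof. by case/andP=> _ /eqP <- dE DE; rewrite /in_mec dE (markov_essential DE) eqxx. Qed.

Lemma not_compelled D i j : orients D -> G i j -> (i, j) \notin compelled D ->
  exists E, [/\ orients E, markov_equiv D E & (j, i) \in E].
Proof.
move=> oD ij; rewrite inE => /forallPn[E]; rewrite negb_imply => /andP[/andP[dE DE] nij].
have oE : orients E.
  apply: dag_orients => // x y; rewrite -(orients_skeleton oD).
  by case/andP: DE => /'forall_'forall_eqP->.
by exists E; split=> //; case: oE => _ ->//; rewrite tree_sym.
Qed.

Lemma ess_imsetP g : is_essential g ->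
  exists2 D, in_mec g D & ess_imset g = char_imset D.
Proof.
move=> [D gD]; rewrite /ess_imset; case: pickP => [E gE|/(_ D)]; last by rewrite gD.
by exists E.
Qed.

Lemma mec_ess_imset g D : is_essential g -> pd_skeleton g =2 G -> in_mec g D ->
  ess_imset g = char_imset D.
Proof.
move=> ess_g skel_g gD; have [D' gD' ->] := ess_imsetP ess_g.
have oD := mec_orients skel_g gD; have oD' := mec_orients skel_g gD'.
apply: (vpar_imset oD' oD); apply/(markov_vpar oD' oD).
exact: (mec_markov skel_g).
Qed.

Lemma Delta_vpar g h D E : orients D -> orients E ->
  ess_imset g = char_imset D -> ess_imset h = char_imset E ->
  Delta G g h = [set i | vpar D i != vpar E i].
Proof.
move=> oD oE gD hE; apply/setP=> i; rewrite !inE gD hE.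
apply/existsP/idP => [[S /andP[iS]] | ].
  by apply: contraNneq => eqv; apply/eqP/(star_vpar oD oE eqv).
move=> ne; apply/existsP; apply: contraTT ne => /existsPn none; rewrite negbK.
apply/eqP/imset_vpar => // S iS; apply/eqP.
by have := none S; rewrite iS negbK.
Qed.

End Tree.

(** * Convex hulls, faces and segments *)

Section Hull.
Variables (R : realFieldType) (V : vectType R).
Implicit Types (P F : V -> Prop) (a b x u v : V).
Local Open Scope ring_scope.

Lemma conv_hull_sub P F x :
  (forall y, P y -> F y) -> conv_hull P x -> conv_hull F x.
Proof.
by move=> PF [n [v [t [Pv t0 t1 ->]]]]; exists n, v, t; split=> // i; apply: PF.
Qed.

Lemma conv_hull_self P x : P x -> conv_hull P x.
Proof.
move=> Px; exists 1%N, (fun=> x), (fun=> 1); split=> //.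
- by rewrite big_ord1.
- by rewrite big_ord1 scale1r.
Qed.

Lemma hull_le P (f : {linear V -> R^o}) (c : R) x :
  (forall y, P y -> f y <= c) -> conv_hull P x -> f x <= c.
Proof.
move=> fP [n [v [t [Pv t0 t1 ->]]]]; rewrite linear_sum /= -[c]mul1r -t1 mulr_suml.
by apply: ler_sum => i _; rewrite linearZ /=; apply: ler_wpM2l => //; apply: fP.
Qed.

(** The nonnegative numbers [t i * (c - f (v i))] have sum zero, so every point of nonzero weight
    attains the bound. *)
Lemma hull_eq P (f : {linear V -> R^o}) (c : R) x :
  (forall y, P y -> f y <= c) -> conv_hull P x -> f x = c ->
  conv_hull (fun y => P y /\ f y = c) x.
Proof.
move=> fP [n [v [t [Pv t0 t1 xE]]]] fx.
have tight i : t i * (c - f (v i)) = 0.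
  have: \sum_i t i * (c - f (v i)) = 0.
    under eq_bigr do rewrite mulrBr.
    rewrite sumrB -mulr_suml t1 mul1r -fx xE linear_sum /=.
    by rewrite -sumrB big1 // => j _; rewrite linearZ /= subrr.
  move/eqP; rewrite psumr_eq0 => [/allP/(_ i)|j _].
    by rewrite mem_index_enum => /(_ isT) /eqP.
  by rewrite mulr_ge0 // subr_ge0 fP.
have [i0 ti0] : exists i, t i != 0.
  apply/existsP; apply: contraT => /existsPn z; move: t1; rewrite big1 => [/eqP|j _].
    by rewrite eq_sym oner_eq0.
  by apply/eqP; have := z j; rewrite negbK.
have tf i : t i != 0 -> f (v i) = c.
  move=> ti; have /eqP := tight i; rewrite mulf_eq0 (negPf ti) /= subr_eq0.
  by move/eqP.
(* Points of weight zero may miss the bound, so they are replaced by [v i0], which attains it. *)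
exists n, (fun i => if t i == 0 then v i0 else v i), t; split=> //.
- by move=> i; case: ifPn => ti; split=> //; apply: tf.
- by rewrite xE; apply: eq_bigr => i _; case: ifPn => // /eqP ->; rewrite !scale0r.
Qed.

Lemma exposed_segment P (f : {linear V -> R^o}) (c : R) a b :
  P a -> P b -> f a = c -> f b = c -> (forall x, P x -> f x <= c) ->
  (forall x, P x -> f x = c -> x = a \/ x = b) ->
  is_face (conv_hull P) (segment a b).
Proof.
move=> Pa Pb fa fb fP only; exists f, c; split=> [x|x]; first exact: hull_le.
split=> [[n [v [t [vE t0 t1 xE]]]] | [Px fx]].
  split; last first.
    rewrite xE linear_sum /= -[c]mul1r -t1 mulr_suml; apply: eq_bigr => i _.
    by rewrite linearZ /=; case: (vE i) => ->; rewrite ?fa ?fb.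
  by exists n, v, t; split=> // i; case: (vE i) => ->.
by apply: conv_hull_sub (hull_eq fP Px fx) => y [Py fy]; apply: only.
Qed.

Lemma segment_affine a b x : segment a b x -> exists t : R, x = a + t *: (b - a).
Proof.
move=> [n [v [t [vE _ t1 ->]]]]; exists (\sum_(i | v i == b) t i).
have -> : a = \sum_i t i *: a by rewrite -scaler_suml t1 scale1r.
rewrite scaler_suml [X in _ + X]big_mkcond -big_split /=; apply: eq_bigr => i _.
case: (eqVneq (v i) b) => [->|].
  by rewrite -scaler_suml t1 scale1r scalerBr addrC subrK.
by case: (vE i) => [->|->]; rewrite ?eqxx ?addr0.
Qed.

Lemma segment_ends a b : segment a b a /\ segment a b b.
Proof. by split; apply: conv_hull_self; [left | right]. Qed.

Lemma segment_dim1 a b : has_dim (segment a b) 1 <-> a <> b.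
Proof.
split=> [[x0 [U [sx0 _ minU dimU]]] ab | /eqP ab].
  have : (U <= 0)%VS.
    apply: minU => x; have [t ->] := segment_affine sx0.
    by case/segment_affine => s ->; rewrite ab !subrr !scaler0 subrr mem0v.
  by rewrite subv0 => /eqP U0; rewrite U0 dimv0 in dimU.
exists a, <[b - a]>%VS; split.
- by case: (segment_ends a b).
- by move=> x /segment_affine[t ->]; rewrite addrC addKr memvZ ?memv_line.
- by move=> W WF; rewrite -memvE WF //; case: (segment_ends a b).
- by rewrite dim_vline subr_eq0 eq_sym ab.
Qed.

(** The supporting functional is at most [c] at [u] and at [v], and its two values add up to
    [c + c], so both are [c]. *)
Lemma face_exchange P a b u v :
  is_face (conv_hull P) (segment a b) -> P u -> P v -> u + v = a + b ->
  segment a b u.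
Proof.
move=> [f [c [fP sE]]] Pu Pv uv.
have [/sE[_ fa] /sE[_ fb]] := segment_ends a b.
have fu := fP u (conv_hull_self Pu); have fv := fP v (conv_hull_self Pv).
have : f u + f v = c + c by rewrite -linearD uv linearD fa fb.
move=> fuv; apply/sE; split; first exact: conv_hull_self.
by apply/eqP; rewrite eq_le fu /=; lra.
Qed.

End Hull.

(** * Affine functions of the characteristic imset *)

Section Affine.
Variables (R : realFieldType) (T : finType) (G : rel T).
Hypothesis treeG : is_tree G.
Implicit Types (D : digraph T) (Q : {set T}).
Local Open Scope ring_scope.

Definition imset_affine (phi : digraph T -> R) : Prop :=
  exists (a : imset_index T -> R) (c : R), forall D, orients G D ->
    phi D = \sum_S a S * (char_imset D S)%:R + c.

Lemma imset_affine_eq phi psi : (forall D, orients G D -> phi D = psi D) ->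
  imset_affine phi -> imset_affine psi.
Proof. by move=> eq [a [c H]]; exists a, c => D oD; rewrite -eq ?H. Qed.

Lemma imset_affine_const (c : R) : imset_affine (fun=> c).
Proof. by exists (fun=> 0), c => D _; rewrite big1 ?add0r // => S _; rewrite mul0r. Qed.

Lemma imset_affine_add phi psi : imset_affine phi -> imset_affine psi ->
  imset_affine (fun D => phi D + psi D).
Proof.
move=> [a [c H]] [a' [c' H']]; exists (fun S => a S + a' S), (c + c') => D oD.
rewrite H // H' // addrACA -big_split /=; congr (_ + _).
by apply: eq_bigr => S _; rewrite mulrDl.
Qed.

Lemma imset_affine_scale (k : R) phi : imset_affine phi -> imset_affine (fun D => k * phi D).
Proof.
move=> [a [c H]]; exists (fun S => k * a S), (k * c) => D oD.
by rewrite H // mulrDr mulr_sumr; congr (_ + _); apply: eq_bigr => S _; rewrite mulrA.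
Qed.

Lemma imset_affine_sum (I : finType) (p : pred I) (phi : I -> digraph T -> R) :
  (forall i, p i -> imset_affine (phi i)) ->
  imset_affine (fun D => \sum_(i | p i) phi i D).
Proof.
move=> H; elim: (index_enum I) => [|i s IH].
  by apply: imset_affine_eq (imset_affine_const 0) => D _; rewrite big_nil.
have [pi|npi] := boolP (p i).
  by apply: imset_affine_eq (imset_affine_add (H i pi) IH) => D _; rewrite big_cons pi.
by apply: imset_affine_eq IH => D _; rewrite big_cons (negPf npi).
Qed.

(** This is the coordinate at [i |: Q] if [Q] consists of neighbours of [i], and zero otherwise. *)
Lemma imset_affine_subset i Q : (1 < #|Q|)%N ->
  imset_affine (fun D => (Q \subset vpar D i)%:R).
Proof.
move=> Q2; have [nbQ|nbQ] := boolP (Q \subset neighbours G i); last first.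
  apply: imset_affine_eq (imset_affine_const 0) => D [sub _].
  rewrite sub_vpar //; case: (boolP (Q \subset _)) => // QD; case/negP: nbQ.
  apply: subset_trans QD _; apply/subsetP=> j; rewrite !inE (tree_sym treeG).
  exact: sub.
have iQ : i \notin Q by apply/negP=> /(subsetP nbQ); rewrite inE (tree_irr treeG).
have cS : (2 < #|i |: Q|)%N by rewrite cardsU1 iQ.
have S2 : (1 < #|i |: Q|)%N by apply: ltn_trans cS.
pose S0 : imset_index T := Sub (i |: Q) S2.
exists (fun S => (S == S0)%:R), 0 => D oD.
rewrite addr0 (bigD1 S0) //= eqxx mul1r big1 => [|S /negPf->]; last by rewrite mul0r.
rewrite addr0 (@imset_star _ G treeG D S0 i) //= ?setU11 //; last by rewrite setU1K.
by rewrite setU1K // sub_vpar.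
Qed.

(* Moebius inversion over the boolean lattice, one level at a time. *)
Lemma imset_affine_vpar_eq i Q : (1 < #|Q|)%N ->
  imset_affine (fun D => (vpar D i == Q)%:R).
Proof.
have [n] := ubnP #|~: Q|; elim: n Q => // n IH Q cQ Q2.
have : imset_affine (fun D => (Q \subset vpar D i)%:R +
    (- 1) * \sum_(Q' : {set T} | Q \proper Q') (vpar D i == Q')%:R).
  apply: imset_affine_add; first exact: imset_affine_subset.
  apply/imset_affine_scale/imset_affine_sum => Q' QQ'; apply: IH.
    apply: leq_trans (_ : #|~: Q| <= n)%N => //.
    by apply: proper_card; rewrite properC.
  exact: ltn_trans Q2 (proper_card QQ').
apply: imset_affine_eq => D _; rewrite mulN1r.
have [QD|nQD] := boolP (Q \proper vpar D i).
  rewrite (proper_sub QD) (bigD1 (vpar D i)) //= eqxx big1 => [|Q' /andP[_]].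
    by rewrite addr0 subrr; case: eqP QD => // ->; rewrite properxx.
  by rewrite eq_sym => /negPf->.
rewrite big1 => [|Q' QQ']; last by case: eqP => // E; rewrite E QQ' in nQD.
by rewrite subr0 eq_sym eqEproper nQD andbT.
Qed.

(** As [vpar D i] is empty or has at least two elements, [phi] is its value at the empty set plus
    corrections on the sets covered by [imset_affine_vpar_eq]. *)
Lemma imset_affine_local i (phi : {set T} -> R) :
  imset_affine (fun D => phi (vpar D i)).
Proof.
have : imset_affine (fun D => phi set0 +
    \sum_(Q : {set T} | (1 < #|Q|)%N) (phi Q - phi set0) * (vpar D i == Q)%:R).
  apply: imset_affine_add; first exact: imset_affine_const.
  apply: imset_affine_sum => Q Q2; apply: imset_affine_scale.
  exact: imset_affine_vpar_eq.
apply: imset_affine_eq => D _; have [v0|vn0] := eqVneq (vpar D i) set0.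
  rewrite v0 big1 ?addr0 // => Q Q2; case: eqP => [Q0|]; last by rewrite mulr0.
  by rewrite -Q0 cards0 in Q2.
have v2 : (1 < #|vpar D i|)%N by move: vn0; rewrite /vpar; case: ifP; rewrite ?eqxx.
rewrite (bigD1 (vpar D i)) //= eqxx mulr1 big1 ?addr0; first by rewrite addrC subrK.
by move=> Q /andP[_]; rewrite eq_sym => /negPf->; rewrite mulr0.
Qed.

Lemma imset_functional (phi : T -> {set T} -> R) :
  exists (f : {linear imset_space R T -> R^o}) (c : R), forall D, orients G D ->
    f (imset_vec R (char_imset D)) = \sum_i phi i (vpar D i) + c.
Proof.
have [a [c H]] : imset_affine (fun D => \sum_i phi i (vpar D i)).
  by apply: imset_affine_sum => i _; apply: imset_affine_local.
pose f0 (v : imset_space R T) : R^o := \sum_S a S * v S.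
have lf : linear f0.
  move=> k u v; rewrite /f0 scaler_sumr -big_split /=; apply: eq_bigr => S _.
  by rewrite !ffunE mulrDr; congr (_ + _); rewrite /GRing.scale /= mulrCA.
pose f := HB.pack_for {linear imset_space R T -> R^o} f0 (GRing.isLinear.Build R _ _ _ f0 lf).
exists f, (- c) => D oD; rewrite H // addrK.
by apply: eq_bigr => S _; rewrite !ffunE.
Qed.

End Affine.

(** * Essential flips and the weight on their arrows *)

Section Flip.
Variables (R : realFieldType) (T : finType) (G : rel T).
Hypothesis treeG : is_tree G.
Variable A : {set T}.
Implicit Types (D E F : digraph T) (i j k : T).

(** The properties of members [D] and [E] of the two classes of an essential flip, with [A] the span
    of Delta. Delta appears as the set where [vpar] differs: [flip_outside] puts it inside [A], and
    [flip_inner] says that the other nodes of [A] are not leaves of [A]. The symmetry in [D] and [E]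
    halves the later work. *)
Record flip_pair D E : Prop := FlipPair {
  flip_orientsl : orients G D;
  flip_orientsr : orients G E;
  flip_rev : forall i j, i \in A -> j \in A -> G i j -> ((i, j) \in E) = ((j, i) \in D);
  flip_compelledl : forall i j, i \in A -> j \in A -> (i, j) \in D -> (i, j) \in compelled D;
  flip_compelledr : forall i j, i \in A -> j \in A -> (i, j) \in E -> (i, j) \in compelled E;
  flip_connected : {in A &, forall i j, connect (induced G A) i j};
  flip_outside : forall i, i \notin A -> vpar D i = vpar E i;
  flip_inner : forall i, i \in A -> vpar D i = vpar E i ->
    exists a b, [/\ a \in A, b \in A, G i a, G i b & a != b] }.

Lemma flip_pair_sym D E : flip_pair D E -> flip_pair E D.
Proof.
case=> oD oE rev cD cE con out inn; split=> //.
- by move=> i j iA jA ij; rewrite (rev j i) // (tree_sym treeG).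
- by move=> i /out.
- by move=> i iA /esym; apply: inn.
Qed.

Definition inner_arrow D : rel T := [rel i j | [&& i \in A, j \in A & (i, j) \in D]].

Lemma inner_arrowP D i j : reflect [/\ i \in A, j \in A & (i, j) \in D] (inner_arrow D i j).
Proof. exact: and3P. Qed.

(* The arrows whose orientation is forced, through nodes with a single parent,
   by an arrow into d end in chain D d. *)
Definition chain D i : {set T} :=
  [set k | connect [rel u v | (#|parents D u| == 1) && inner_arrow D u v] i k
           & #|parents D k| == 1].

Lemma chain_eq0 D i : #|parents D i| != 1 -> chain D i = set0.
Proof.
move=> npar; apply/setP=> k; rewrite !inE; apply/negP=> /andP[ik park].
have /eqP kE : k == i.
  apply: (@connect_preserves _ _ [pred u | u == i] _ _ _ ik (eqxx i)) => u v.
  by move=> /andP[+ _] /eqP uE; rewrite uE (negPf npar).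
by rewrite kE (negPf npar) in park.
Qed.

(** A step out of a node with a single parent prolongs the chain, and [i] does not recur because [D]
    is acyclic. *)
Lemma chain_sub D i j : orients G D -> #|parents D i| == 1 -> inner_arrow D i j ->
  i |: chain D j \subset chain D i /\ i \notin chain D j.
Proof.
move=> oD pari ij; split.
  apply/subsetP=> k; rewrite !inE => /orP[/eqP->|/andP[jk ->]]; first by rewrite connect0.
  by rewrite andbT; apply: connect_trans jk; apply: connect1; rewrite /= pari.
rewrite inE negb_and; apply/orP; left; apply/negP=> ji.
have /forallP/(_ i)/forallP/(_ j)/implyP := orients_dag treeG oD.
have /and3P[_ _ ijD] := ij; move/(_ ijD)/negP; apply.
by apply: connect_sub ji => u v /andP[_ /and3P[_ _ uv]]; apply: connect1.
Qed.

Lemma chain_lt D i j : orients G D -> #|parents D i| == 1 -> inner_arrow D i j ->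
  #|chain D j| < #|chain D i|.
Proof.
move=> oD pari ij; have [/subset_leq_card + ni] := chain_sub oD pari ij.
by rewrite cardsU1 ni.
Qed.

Lemma chain_succ D i j : orients G D -> #|parents D i| == 1 -> inner_arrow D i j ->
  (forall k, inner_arrow D i k -> k = j) -> #|chain D i| = #|chain D j|.+1.
Proof.
move=> oD pari ij only; have [sub ni] := chain_sub oD pari ij.
suff -> : chain D i = i |: chain D j by rewrite cardsU1 ni.
apply/eqP; rewrite eqEsubset sub andbT; apply/subsetP=> k.
rewrite !inE => /andP[/connectP[p ip ->] ->]; rewrite andbT.
case: p ip => [|l p] /=; first by rewrite eqxx.
case/andP=> /andP[_ /only ->] jp; apply/orP; right.
by apply/connectP; exists p.
Qed.

(* For an arrow i -> j of D, reversed in E.  At a node i whose only parent in D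
   is z, and with several parents in E, excess_ge0 needs lam z i to be negative
   and smaller than lam i b for every i -> b; at a node with the same
   v-structures in D and E, the inflow and the outflow must be equal. *)
Definition lam D E i j : R :=
  let k := (#|chain D j| + #|chain E i|)%N in (if k == 0%N then 1 else - k%:R)%R.

Lemma lamC D E i j : lam E D j i = lam D E i j.
Proof. by rewrite /lam addnC. Qed.

Lemma card_parents1 D i j : #|parents D i| <= 1 -> (j, i) \in D -> parents D i = [set j].
Proof.
move=> le ji; apply/esym/eqP; rewrite eqEcard cards1 le andbT sub1set.
by rewrite in_parents.
Qed.

Lemma orients_irr D i : orients G D -> (i, i) \notin D.
Proof. by case=> sub _; apply/negP=> /sub; rewrite (tree_irr treeG). Qed.

(** A neighbour of [i] in [A] is a parent of [i] in exactly one of [D] and [E]. A common nonempty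
    [vpar] is thus impossible, so [i] has at most one parent in each graph, and its two neighbours
    in [A] supply one each. *)
Lemma flip_inner_node D E i : flip_pair D E -> i \in A -> vpar D i = vpar E i ->
  exists a b, [/\ a \in A, b \in A, parents D i = [set a], parents E i = [set b]
    & forall c, c \in A -> G i c -> c = a \/ c = b].
Proof.
move=> fp iA eqv; have [oD oE rev _ _ _ _ inn] := fp.
have [a [b [aA bA ia ib ab]]] := inn i iA eqv.
have parE c : c \in A -> G i c -> ((c, i) \in E) = ((c, i) \notin D).
  by move=> cA ic; rewrite rev // ?(tree_sym treeG c) //; case: oD => _ ->.
have v0 : vpar D i = set0.
  apply/eqP; apply: contraT => vn0; have := parE a aA ia.
  rewrite -!in_parents -(vpar_parents vn0) eqv -(@vpar_parents _ E) -?eqv //.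
  by case: (_ \in _).
have leD := vpar0 v0; have leE : #|parents E i| <= 1 by apply: vpar0; rewrite -eqv.
have key c d : c \in A -> d \in A -> G i c -> G i d -> c != d -> (c, i) \in D ->
    [/\ parents D i = [set c], parents E i = [set d]
      & forall e, e \in A -> G i e -> e = c \/ e = d].
  move=> cA dA ic id_ cd ci; have pD := card_parents1 leD ci.
  have diE : (d, i) \in E by rewrite parE // -in_parents pD inE eq_sym.
  have pE := card_parents1 leE diE; split=> // e eA ie.
  have [eD|] := boolP ((e, i) \in D); last rewrite -parE // => eE.
    by left; apply/eqP; rewrite -in_set1 -pD in_parents.
  by right; apply/eqP; rewrite -in_set1 -pE in_parents.
have [aD|aD] := boolP ((a, i) \in D).
  by have [? ? ?] := key a b aA bA ia ib ab aD; exists a, b.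
have aE : (a, i) \in E by rewrite parE.
have bD : (b, i) \in D.
  apply: contraT => bD; have bE : (b, i) \in E by rewrite parE.
  have := card_parents1 leE aE; rewrite (card_parents1 leE bE) => /set1_inj ba.
  by rewrite ba eqxx in ab.
rewrite eq_sym in ab.
by have [? ? ?] := key b a bA aA ib ia ab bD; exists b, a.
Qed.

(** Passing from the arrow [a -> i] to [i -> b], the chain in [D] loses the node [i] and the chain
    in [E] gains it, so the sum of their sizes is unchanged. *)
Lemma flip_inner_lam D E i a b : flip_pair D E -> i \in A -> a \in A -> b \in A ->
  parents D i = [set a] -> parents E i = [set b] ->
  (forall c, c \in A -> G i c -> c = a \/ c = b) -> lam D E a i = lam D E i b.
Proof.
move=> fp iA aA bA pD pE nb; have [oD oE rev _ _ _ _ _] := fp.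
have [[subD totD] [subE totE]] := (oD, oE).
have aiD : (a, i) \in D by rewrite -in_parents pD set11.
have biE : (b, i) \in E by rewrite -in_parents pE set11.
have ia : G i a by rewrite (tree_sym treeG) subD.
have ib : G i b by rewrite (tree_sym treeG) subE.
have ibD : (i, b) \in D by rewrite -(rev b i) // (tree_sym treeG).
have iaE : (i, a) \in E by rewrite rev.
have cD : #|chain D i| = #|chain D b|.+1.
  apply: chain_succ; rewrite ?pD ?cards1 //; first exact/inner_arrowP.
  move=> c /inner_arrowP[_ cA ic]; case: (nb c cA (subD _ _ ic)) => // ca.
  by have := orients_antisym oD ic; rewrite ca aiD.
have cE : #|chain E i| = #|chain E a|.+1.
  apply: chain_succ; rewrite ?pE ?cards1 //; first exact/inner_arrowP.
  move=> c /inner_arrowP[_ cA ic]; case: (nb c cA (subE _ _ ic)) => // cb.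
  by have := orients_antisym oE ic; rewrite cb biE.
by rewrite /lam cD cE addSn addnS.
Qed.

Lemma vpar_ext D E i : parents D i = parents E i -> vpar D i = vpar E i.
Proof. by rewrite /vpar => ->. Qed.

Lemma vpar_small D i : #|parents D i| <= 1 -> vpar D i = set0.
Proof. by rewrite /vpar ltnNge => ->. Qed.

(** Take for [W] the branch behind the only parent of [d], or the empty set if there is none. The
    connected set [A] contains [d] but not this parent, so it does not enter the branch. *)
Lemma outside_branch D E d : flip_pair D E -> d \in A -> #|parents D d| <= 1 ->
  [disjoint parents D d & A] ->
  exists W : {set T}, [/\ [disjoint W & A], parents D d \subset W
    & forall i j, i \in W -> j \notin W -> G i j -> i \in parents D d /\ j = d].
Proof.
move=> fp dA le dis; have [p0|[w wd]] := set_0Vmem (parents D d).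
  by exists set0; split; [rewrite -setI_eq0 set0I | rewrite p0 | move=> i j; rewrite inE].
rewrite in_parents in wd; have pE := card_parents1 le wd.
have [[sub tot] _ _ _ _ con _ _] := fp; have Gwd := sub _ _ wd.
have wA : w \notin A by move: dis; rewrite pE disjoints1.
exists (cut G w d); split; last 2 first.
- by rewrite pE sub1set cut_self.
- by move=> i j iW jW ij; have [-> ->] := cut_cross treeG Gwd iW jW ij; rewrite pE set11.
rewrite disjoint_sym disjoint_subset; apply/subsetP=> a aA.
apply: (@connect_preserves _ _ [predC cut G w d] _ _ _ (con _ _ dA aA)); last first.
  exact: (cut_other treeG Gwd).
move=> u v /and3P[uA vA uv] /= uC; apply/negP=> vC.
rewrite (tree_sym treeG) in uv.
by have [vw _] := cut_cross treeG Gwd vC uC uv; rewrite vw (negPf wA) in vA.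
Qed.

(* Otherwise reversing d -> b, and orienting the branches outside A as in D',
   would give a Markov equivalent graph, although d -> b is compelled. *)
Lemma flip_no_back D E D' d b b' : flip_pair D E -> orients G D' ->
  (forall k, k \notin A -> vpar D' k = vpar D k) ->
  d \in A -> b \in A -> b' \in A -> (d, b) \in D -> parents D b = [set d] ->
  #|parents D d| <= 1 -> [disjoint parents D d & A] -> vpar D' d = set0 ->
  (b', d) \notin D'.
Proof.
move=> fp oD' out dA bA b'A db pb le dis v0; apply/negP=> b'd.
have [oD _ _ comp _ _ _ _] := fp.
have [[sub tot] [sub' tot']] := (oD, oD').
have [W [WA pW Wcross]] := outside_branch fp dA le dis.
have notW x : x \in A -> x \notin W by move=> xA; rewrite (disjointFl WA xA).
have [[dW bW] b'W] := (notW d dA, notW b bA, notW b' b'A).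
have bd : b != d by apply: contraTneq db => ->; apply: orients_irr.
pose pa i := if i \in W then parents D' i else if i == d then [set b]
             else if i == b then set0 else parents D i.
pose F := of_parents pa.
have GC := tree_sym treeG.
have dF i : i \notin W -> i != b -> G d i -> (d, i) \in D.
  move=> iW ib di; rewrite tot //; apply: contra iW => id_.
  by rewrite (subsetP pW) // in_parents.
have bF i : i != d -> G b i -> (b, i) \in D.
  by move=> id_ bi; rewrite tot // -in_parents pb inE.
(* The only parent of [d] in [D'] is [b'], which lies in [A], so [D'] orients the edge between [d]
   and [W] away from [d]. *)
have dW' i : i \in W -> G i d -> (d, i) \in D'.
  move=> iW Gid; rewrite tot' 1?GC //; apply/negP; rewrite -in_parents.
  rewrite (card_parents1 (vpar0 v0) b'd) inE => /eqP ib'.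
  by rewrite ib' (negPf b'W) in iW.
have cross i j : i \in W -> j \notin W -> G i j -> (i \notin pa j) && (j \in pa i).
  move=> iW jW ij; have [_ jd] := Wcross i j iW jW ij.
  rewrite jd in ij *; rewrite /pa iW (negPf dW) eqxx in_set1 in_parents dW' // andbT.
  by apply: contraNneq bW => <-.
have oF : orients G F.
  split=> i j; rewrite !inE /=.
    rewrite /pa; case: ifP => _; first by rewrite in_parents; apply: sub'.
    case: eqP => [-> /set1P ->|_]; first by rewrite GC; apply: sub.
    by case: eqP => _; rewrite ?in_set0 // in_parents; apply: sub.
  move=> ij; have ji : G j i by rewrite GC.
  have [iW|iW] := boolP (i \in W); have [jW|jW] := boolP (j \in W).
  - by rewrite /pa iW jW !in_parents; apply: tot'.
  - by have /andP[/negPf-> ->] := cross i j iW jW ij.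
  - by have /andP[-> ->] := cross j i jW iW ji.
  rewrite /pa (negPf iW) (negPf jW).
  have [jd|jd] := eqVneq j d; have [id_|id_] := eqVneq i d.
  - by rewrite jd id_ (tree_irr treeG) in ij.
  - rewrite in_set1; have [_|ib] := eqVneq i b; first by rewrite in_set0.
    by rewrite in_parents jd dF // -jd.
  - rewrite in_set1; have [_|jb] /= := eqVneq j b; first by rewrite in_set0.
    by rewrite in_parents id_ dF // -id_.
  have [jb|jb] := eqVneq j b; have [ib|ib] := eqVneq i b.
  - by rewrite jb ib (tree_irr treeG) in ij.
  - by rewrite in_set0 in_parents jb bF // -jb.
  - by rewrite in_set0 in_parents ib bF // -ib.
  by rewrite !in_parents; apply: tot.
(* Both [d] and [b] have at most one parent in [D] and in [F], and elsewhere [vpar] is kept, on [W]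
   by the assumption on [D']. *)
have eqF : markov_equiv D F.
  apply/(markov_vpar treeG oD oF) => i; have pF : parents F i = pa i by apply: parents_of.
  have [iW|iW] := boolP (i \in W).
    rewrite -out; last by rewrite (disjointFr WA iW).
    by apply: vpar_ext; rewrite pF /pa iW.
  have [id_|id_] := eqVneq i d.
    by rewrite id_ in pF iW *; rewrite !vpar_small // pF /pa (negPf iW) eqxx cards1.
  have [ib|ib] := eqVneq i b.
    rewrite ib in pF iW id_ *; rewrite !vpar_small // ?pb ?cards1 //.
    by rewrite pF /pa (negPf iW) (negPf id_) eqxx cards0.
  by apply: vpar_ext; rewrite pF /pa (negPf iW) (negPf id_) (negPf ib).
have /compelledP/(_ F (orients_dag treeG oF) eqF) := comp d b dA bA db.
by rewrite inE /= /pa (negPf bW) (negPf bd) eqxx inE.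
Qed.

End Flip.

(** * Charges and local excesses *)

Section Excess.
Variables (R : realFieldType) (T : finType) (G : rel T).
Hypothesis treeG : is_tree G.
Variable A : {set T}.
Implicit Types (D E F : digraph T) (i j k : T).
Local Open Scope ring_scope.
Local Notation lamA := (lam R A).
Local Notation inner := (inner_arrow A).

(** Each arrow is counted once at its head and once at its tail, with opposite signs. *)
Lemma sum_circulation (P : rel T) (L : T -> T -> R) :
  \sum_i (\sum_(j | P j i) L j i - \sum_(j | P i j) L i j) = 0.
Proof.
rewrite sumrB; under eq_bigr do rewrite big_mkcond.
under [X in _ - X]eq_bigr do rewrite big_mkcond.
by rewrite exchange_big subrr.
Qed.

Definition net D E i : R :=
  \sum_(j | inner D j i) lamA D E j i - \sum_(j | inner D i j) lamA D E i j.

Lemma sum_net D E : \sum_i net D E i = 0.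
Proof. exact: sum_circulation. Qed.

(** In [A], such a node has one inner arrow in and one out, of equal weight by [flip_inner_lam].
    This makes the total charge vanish at [E], where only such nodes collect it. *)
Lemma net0 D E i : flip_pair G A D E -> vpar D i = vpar E i -> net D E i = 0.
Proof.
move=> fp eqv; have [iA|iA] := boolP (i \in A); last first.
  rewrite /net !big_pred0 ?subrr // => j; apply/negbTE.
    by apply/negP=> /inner_arrowP[iA' _ _]; rewrite iA' in iA.
  by apply/negP=> /inner_arrowP[_ iA' _]; rewrite iA' in iA.
have [a [b [aA bA pD pE nb]]] := flip_inner_node treeG fp iA eqv.
have [oD oE rev _ _ _ _ _] := fp; have [[sub tot] [subE _]] := (oD, oE).
have inD j : ((j, i) \in D) = (j == a) by rewrite -in_parents pD inE.
have inE_ j : ((j, i) \in E) = (j == b) by rewrite -in_parents pE inE.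
have ibD : (i, b) \in D.
  by rewrite -(rev b i) ?inE_ ?eqxx //; apply: subE; rewrite inE_.
rewrite /net (big_pred1 a) => [|j]; last first.
  apply/inner_arrowP/eqP => [[_ _]|->]; first by rewrite inD => /eqP.
  by split=> //; rewrite inD.
rewrite (big_pred1 b) => [|j]; last first.
  apply/inner_arrowP/eqP => [[_ jA ij]|-> //].
  case: (nb j jA (sub _ _ ij)) => // ja.
  by have := orients_antisym oD ij; rewrite inD ja eqxx.
by rewrite (flip_inner_lam R treeG fp iA aA bA pD pE nb) subrr.
Qed.

(** Outflow minus inflow over the arrows of [D] that [F] reverses; [net_flow] relates it to the
    charge. *)
Definition excess D E F i : R :=
  \sum_(j | inner D i j && ((j, i) \in F)) lamA D E i j -
  \sum_(j | inner D j i && ((i, j) \in F)) lamA D E j i.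

(** Only parents in [A] are compared: [F] may orient the branches outside [A] differently without
    changing v-structures. *)
Definition agree F D i := forall j, j \in A -> ((j, i) \in F) = ((j, i) \in D).

Lemma agree_parents F D i : parents F i = parents D i -> agree F D i.
Proof. by move=> eq j _; rewrite -!in_parents eq. Qed.

Lemma agree_excess D E F i : orients G D -> orients G F -> agree F D i -> excess D E F i = 0.
Proof.
move=> oD oF ag; rewrite /excess !big_pred0 ?subrr // => j; apply/negbTE/negP.
  move=> /andP[/inner_arrowP[jA iA ji]]; apply/negP/(orients_antisym oF).
  by rewrite ag.
move=> /andP[/inner_arrowP[iA jA ij]]; rewrite ag //.
exact/negP/(orients_antisym oD).
Qed.

(** If [vpar D i] is nonempty the parents agree. Otherwise [i] has at most one parent in [D] and in
    [F], so at most one arrow into [i] and one out of [i] contribute, and the cases depend on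
    whether these parents lie in [A]. *)
Lemma excess_ge0 D E F i : flip_pair G A D E -> orients G F ->
  (forall k, k \notin A -> vpar F k = vpar D k) -> i \in A -> vpar F i = vpar D i ->
  0 <= excess D E F i /\
  (excess D E F i = 0 -> agree F D i \/ (vpar D i = vpar E i /\ agree F E i)).
Proof.
move=> fp oF out iA eqv; have [oD oE rev _ _ _ _ _] := fp.
have GC := tree_sym treeG.
have [[sub tot] [subE totE] [subF totF]] : [/\ _ D, _ E & _ F] := And3 oD oE oF.
have trivial : agree F D i -> 0 <= excess D E F i /\
    (excess D E F i = 0 -> agree F D i \/ (vpar D i = vpar E i /\ agree F E i)).
  by move=> ag; rewrite agree_excess //; split=> //; left.
have [v0|vn0] := eqVneq (vpar D i) set0; last first.
  apply/trivial/agree_parents.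
  by rewrite -(vpar_parents vn0) -eqv vpar_parents // eqv.
have leD := vpar0 v0; have leF : (#|parents F i| <= 1)%N by apply: vpar0; rewrite eqv.
have [disD|/pred0Pn[z /andP[/= zi zA]]] := boolP [disjoint parents D i & A].
  have [disF|/pred0Pn[b /andP[/= bi bA]]] := boolP [disjoint parents F i & A].
    apply: trivial => j jA; rewrite -!in_parents.
    by rewrite (disjointFl disF) // (disjointFl disD).
  rewrite in_parents in bi; have pF := card_parents1 leF bi.
  have ib : (i, b) \in D.
    by rewrite tot 1?GC ?subF // -in_parents (disjointFl disD).
  have -> : excess D E F i = lamA D E i b.
    rewrite /excess (big_pred1 b) => [|j /=]; last first.
      rewrite -in_parents pF inE andbC; case: eqP => //= ->.
      exact/inner_arrowP.
    rewrite big_pred0 ?subr0 // => j; apply/negbTE/negP.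
    move=> /andP[/inner_arrowP[jA _ ji] _].
    by have := disjointFl disD jA; rewrite in_parents ji.
  (* Both chains are empty, which gives the weight 1: if [i] had a single parent in [E], it would
     have a parent in [A] in [D] by [flip_inner_node]; if [i] were the only parent of [b] in [D],
     then [flip_no_back] would exclude [b -> i] from [F]. *)
  suff -> : lamA D E i b = 1 by split=> // /eqP; rewrite oner_eq0.
  rewrite /lam chain_eq0 ?cards0 ?chain_eq0 ?cards0 //.
    apply/negP=> /cards1P[w pE]; have vE : vpar D i = vpar E i.
      by rewrite v0 vpar_small // pE cards1.
    have [a [_ [aA _ pD _ _]]] := flip_inner_node treeG fp iA vE.
    by move: disD; rewrite pD disjoints1 aA.
  apply/negP=> /eqP pb1; have pb : parents D b = [set i].
    by apply: card_parents1 => //; rewrite pb1.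
  move: bi; apply/negP.
  apply: (flip_no_back treeG fp oF out iA bA bA ib pb leD disD).
  by rewrite eqv.
rewrite in_parents in zi; have pD := card_parents1 leD zi.
have iz := sub _ _ zi; rewrite GC in iz.
have [ziF|ziF] := boolP ((z, i) \in F).
  by apply/trivial/agree_parents; rewrite pD (card_parents1 leF ziF).
have izF : (i, z) \in F by rewrite totF.
have sumin : \sum_(j | inner D j i && ((i, j) \in F)) lamA D E j i = lamA D E z i.
  rewrite (big_pred1 z) // => j /=; apply/andP/eqP => [[/inner_arrowP[_ _ ji] _]|->].
    by move: ji; rewrite -in_parents pD inE => /eqP.
  by split=> //; apply/inner_arrowP.
(* The node [i] belongs to its own chain, which makes the weight of [z -> i] negative. *)
have ci : (0 < #|chain A D i|)%N.
  by rewrite card_gt0; apply/set0Pn; exists i; rewrite inE connect0 pD cards1.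
have lamz : lamA D E z i = - (#|chain A D i| + #|chain A E z|)%:R.
  by rewrite /lam ifN // -lt0n addn_gt0 ci.
have [/existsP[b /andP[/inner_arrowP[_ bA ib] bi]]|none] :=
  boolP [exists b, inner D i b && ((b, i) \in F)]; last first.
  have -> : excess D E F i = - lamA D E z i.
    rewrite /excess sumin big_pred0 ?sub0r // => j; apply/negbTE.
    by apply: contra none => ?; apply/existsP; exists j.
  rewrite lamz opprK; split; first exact: ler0n.
  by move/eqP; rewrite pnatr_eq0 addn_eq0 -leqn0 leqNgt ci.
have pF := card_parents1 leF bi.
have exE : excess D E F i = lamA D E i b - lamA D E z i.
  rewrite /excess sumin (big_pred1 b) // => j /=; rewrite -in_parents pF inE andbC.
  by case: eqP => //= ->; apply/inner_arrowP.
have [vE|vE] := eqVneq (vpar D i) (vpar E i).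
  have [a [c [aA cA pD' pE nb]]] := flip_inner_node treeG fp iA vE.
  have az : a = z by apply: set1_inj; rewrite -pD -pD'.
  have bc : b = c.
    case: (nb b bA (sub _ _ ib)) => // ba.
    by have := orients_antisym oD ib; rewrite ba az zi.
  rewrite exE bc -az (flip_inner_lam R treeG fp iA aA cA pD' pE nb) subrr.
  by split=> // _; right; split=> //; apply: agree_parents; rewrite pE pF bc.
(* Here [i] has several parents in [E], so its chain in [E] is empty. The weight of [i -> b] is then
   1, or minus the size of a chain smaller than that of [i]; in both cases it exceeds the weight of
   [z -> i]. *)
have cE : #|chain A E i| = 0%N.
  rewrite chain_eq0 ?cards0 //; apply: contra vE => /eqP pE1.
  by rewrite v0 vpar_small // pE1.
have lt : (#|chain A D b| < #|chain A D i|)%N.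
  apply: (chain_lt treeG oD); first by rewrite pD cards1.
  exact/inner_arrowP.
suff pos : 0 < excess D E F i.
  by split; [apply: ltW | move=> e0; rewrite e0 ltxx in pos].
rewrite exE lamz opprK /lam cE addn0; case: eqP => _.
  by rewrite ltr_wpDr // ler0n.
by rewrite addrC subr_gt0 ltr_nat ltn_addr.
Qed.

End Excess.

(** * A sum of local functions maximised only at the two classes of a flip *)

Section FlipMax.
Variables (R : realFieldType) (T : finType) (G : rel T).
Hypothesis treeG : is_tree G.
Variable A : {set T}.
Implicit Types (D E F : digraph T) (i j k : T).
Local Open Scope ring_scope.
Local Notation lamA := (lam R A).
Local Notation inner := (inner_arrow A).
Local Notation netA := (net R A).
Local Notation excessA := (excess R A).

Lemma inner_rev D E i j : flip_pair G A D E -> inner E i j = inner D j i.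
Proof.
move=> [[sub tot] [subE _] rev _ _ _ _ _].
apply/inner_arrowP/inner_arrowP => -[iA jA ij]; split=> //.
  by rewrite -rev // subE.
by rewrite rev // (tree_sym treeG) sub.
Qed.

Lemma excess_out D E F i : i \notin A -> excessA D E F i = 0.
Proof.
move=> iA; rewrite /excess !big_pred0 ?subrr // => j; apply/negbTE/negP.
  by move=> /andP[/inner_arrowP[_ iA']]; rewrite iA' in iA.
by move=> /andP[/inner_arrowP[iA']]; rewrite iA' in iA.
Qed.

Definition flow D E F i : R :=
  \sum_(j | inner D j i && ((j, i) \in F)) lamA D E j i -
  \sum_(j | inner D i j && ((i, j) \in F)) lamA D E i j.

Lemma net_flow D E F i : orients G D -> orients G F ->
  netA D E i - flow D E F i = - excessA D E F i.
Proof.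
move=> [sub tot] [subF totF]; have GC := tree_sym treeG.
have inE_ : \sum_(j | inner D j i) lamA D E j i =
    \sum_(j | inner D j i && ((j, i) \in F)) lamA D E j i +
    \sum_(j | inner D j i && ((i, j) \in F)) lamA D E j i.
  rewrite (bigID (fun j => (j, i) \in F)) /=; congr (_ + _); apply: eq_bigl => j.
  by case: inner_arrowP => //= -[_ _ /sub ji]; rewrite totF ?negbK // GC.
have outE : \sum_(j | inner D i j) lamA D E i j =
    \sum_(j | inner D i j && ((i, j) \in F)) lamA D E i j +
    \sum_(j | inner D i j && ((j, i) \in F)) lamA D E i j.
  rewrite (bigID (fun j => (i, j) \in F)) /=; congr (_ + _); apply: eq_bigl => j.
  by case: inner_arrowP => //= -[_ _ /sub ij]; rewrite totF ?negbK // GC.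
rewrite /net /excess /flow inE_ outE; lra.
Qed.

(** The arrows of [D] kept by [F] are, read backwards, the arrows of [E] reversed by [F], and [lam]
    is symmetric under this exchange. *)
Lemma flow_excess D E F i : flip_pair G A D E -> 
  - flow D E F i = - excessA E D F i.
Proof.
move=> fp; rewrite /excess /flow; congr (- (_ - _)).
  by apply: eq_big => j; [rewrite (inner_rev _ _ fp) | rewrite lamC].
by apply: eq_big => j; [rewrite (inner_rev _ _ fp) | rewrite lamC].
Qed.

Lemma flip_max D E : flip_pair G A D E -> (exists i, vpar D i != vpar E i) ->
  exists phi : T -> {set T} -> R,
  [/\ \sum_i phi i (vpar D i) = 0, \sum_i phi i (vpar E i) = 0 &
   forall F, orients G F -> \sum_i phi i (vpar F i) <= 0 /\
     (\sum_i phi i (vpar F i) = 0 ->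
       (forall i, vpar F i = vpar D i) \/ (forall i, vpar F i = vpar E i))].
Proof.
move=> fp [d dDE]; have [oD oE rev _ _ con out _] := fp.
have fp' := flip_pair_sym treeG fp.
(* A single penalty [- M] outweighs all the charges together. *)
pose M := 1 + \sum_i `|netA D E i|.
pose phi i Q := if Q == vpar D i then netA D E i else if Q == vpar E i then 0 else - M.
have M0 : 0 <= M by rewrite addr_ge0 // sumr_ge0.
exists phi; split.
- by under eq_bigr do rewrite /phi eqxx; apply: sum_net.
- rewrite big1 // => i _; rewrite /phi eqxx; case: eqP => // eqv.
  by apply: (net0 R treeG fp).
move=> F oF; have [good|bad] :=
  boolP [forall i, (vpar F i == vpar D i) || (vpar F i == vpar E i)]; last first.
  suff lt0 : \sum_i phi i (vpar F i) < 0.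
    by split; [apply: ltW | move=> e0; rewrite e0 ltxx in lt0].
  have [i0] := existsP bad; rewrite negb_or => /andP[/negPf n1 /negPf n2].
  have le i : phi i (vpar F i) <= `|netA D E i|.
    rewrite /phi; case: ifP => _; first exact: ler_norm.
    by case: ifP => _ //; apply: le_trans (normr_ge0 _); rewrite oppr_le0.
  rewrite (bigD1 i0) //= {1}/phi n1 n2 /M (bigD1 i0) //=.
  have := normr_ge0 (netA D E i0).
  have : \sum_(i | i != i0) phi i (vpar F i) <= \sum_(i | i != i0) `|netA D E i|.
    by apply: ler_sum.
  by move=> h1 h2; rewrite opprD opprD; lra.
have {}good i : vpar F i = vpar D i \/ vpar F i = vpar E i.
  by have /orP[] := forallP good i => /eqP; [left | right].
have outD k : k \notin A -> vpar F k = vpar D k.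
  by move=> kA; case: (good k) => // ->; rewrite out.
have outE k : k \notin A -> vpar F k = vpar E k by move=> kA; rewrite outD // out.
pose exc i := if vpar F i == vpar D i then excessA D E F i else excessA E D F i.
(* With [vpar] as in [D], the charge is the flow minus the excess; with [vpar] as in [E] only, the
   value 0 is the flow minus the excess with [D] and [E] exchanged. The flows cancel in the sum over
   all nodes. *)
have phiE i : phi i (vpar F i) = flow D E F i - exc i.
  rewrite /phi /exc; case: eqP => [_|nD].
    by rewrite -(net_flow E i oD oF) addrC subrK.
  case: (good i) => // ->; rewrite eqxx -(flow_excess F i fp).
  by rewrite subrr.
have -> : \sum_i phi i (vpar F i) = - \sum_i exc i.
  rewrite (eq_bigr _ (fun i _ => phiE i)) sumrB [X in X - _]sum_circulation.
  by rewrite sub0r.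
have exc_ge0 i : 0 <= exc i.
  rewrite /exc; have [iA|iA] := boolP (i \in A); last first.
    by case: ifP => _; rewrite excess_out.
  case: eqP => [eqD|neD]; first by case: (excess_ge0 R treeG fp oF outD iA eqD).
  have eqE : vpar F i = vpar E i by case: (good i).
  by case: (excess_ge0 R treeG fp' oF outE iA eqE).
split; first by rewrite oppr_le0 sumr_ge0.
move/eqP; rewrite oppr_eq0 psumr_eq0 // => /allP exc0.
have {}exc0 i : exc i = 0 by apply/eqP/exc0; rewrite mem_index_enum.
have agrD i : i \in A -> vpar F i = vpar D i -> agree A F D i \/ agree A F E i.
  move=> iA eqD; have [_ H] := excess_ge0 R treeG fp oF outD iA eqD.
  have := exc0 i; rewrite /exc eqD eqxx => /H[]; first by left.
  by case=> _; right.
have agrD' i : i \in A -> vpar F i = vpar D i -> vpar D i != vpar E i -> agree A F D i.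
  move=> iA eqD ne; have [_ H] := excess_ge0 R treeG fp oF outD iA eqD.
  have := exc0 i; rewrite /exc eqD eqxx => /H[] //.
  by case=> eqv _; rewrite eqv eqxx in ne.
have agrE i : i \in A -> vpar F i <> vpar D i -> agree A F E i.
  move=> iA neD; have eqE : vpar F i = vpar E i by case: (good i).
  have [_ H] := excess_ge0 R treeG fp' oF outE iA eqE.
  have := exc0 i; rewrite /exc; case: eqP => // _ /H[] //.
  by case=> eqv _; case: neD; rewrite eqE.
have agr i : i \in A -> agree A F D i \/ agree A F E i.
  move=> iA; have [eqD|/eqP neD] := eqVneq (vpar F i) (vpar D i).
    exact: agrD.
  by right; apply: agrE.
(* The edge between [i] and [j] has opposite orientations in [D] and [E], so [F] cannot follow [D]
   at one end and [E] at the other. *)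
have not_both i j : i \in A -> j \in A -> G i j -> agree A F D i -> agree A F E j -> False.
  move=> iA jA ij agi agj; have ji : G j i by rewrite (tree_sym treeG).
  have := agj i iA; rewrite rev // -agi // => /eqP.
  by have [_ tot] := oF; rewrite (tot i j) //; case: (_ \in _).
(* A node where [vpar F] is that of [D] but not that of [E] forces agreement with [D] there, and
   this spreads over the connected set [A]. Without such a node, [vpar F] is that of [E]
   everywhere. *)
have [/existsP[i /and3P[iA /eqP eqD neq]]|none] :=
  boolP [exists i, [&& i \in A, vpar F i == vpar D i & vpar D i != vpar E i]]; last first.
  right=> k; have [kA|] := boolP (k \in A); last exact: outE.
  case: (good k) => // eqD; rewrite eqD; apply/eqP; apply: contraNT none => ne.
  by apply/existsP; exists k; rewrite kA eqD eqxx.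
left=> k; have [kA|] := boolP (k \in A); last exact: outD.
have [->//|ki] := eqVneq k i.
have agi := agrD' i iA eqD neq.
have agall l : l \in A -> agree A F D l.
  move=> lA; pose ag l := [forall j in A, ((j, l) \in F) == ((j, l) \in D)].
  suff /forall_inP H : ag l by move=> j /H /eqP.
  apply: (@connect_preserves _ _ ag _ _ _ (con _ _ iA lA)); last first.
    by apply/forall_inP=> j jA; apply/eqP/agi.
  move=> u v /and3P[uA vA uv] /forall_inP agu.
  case: (agr v vA) => [agv|agv]; first by apply/forall_inP=> j jA; apply/eqP/agv.
  by case: (@not_both u v) => // j /agu /eqP.
have [//|/eqP neD] := eqVneq (vpar F k) (vpar D k).
have agk := agrE _ kA neD.
have [l /and3P[_ lA kl]] := connect_first (con _ _ kA iA) ki.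
by case: (@not_both l k); rewrite ?(tree_sym treeG l) //; apply: agall.
Qed.

End FlipMax.

(** * Edges of the polytope and essential flips *)

Section Edges.
Variables (R : realFieldType) (T : finType) (G : rel T) (g h : pdgraph T).
Hypothesis treeG : is_tree G.
Hypotheses (ess_g : is_essential g) (skel_g : pd_skeleton g =2 G).
Hypotheses (ess_h : is_essential h) (skel_h : pd_skeleton h =2 G).
Implicit Types (D E : digraph T) (i j : T).
Local Notation vec := (imset_vec R).
Local Notation A := (Defs.span G (Delta G g h)).
Local Open Scope ring_scope.

Lemma imset_vec_inj : injective (@imset_vec R T).
Proof.
move=> c d /ffunP eq; apply/ffunP=> S; have := eq S; rewrite !ffunE.
case: (c S); case: (d S) => //= /eqP; last rewrite eq_sym.
  by rewrite oner_eq0.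
by rewrite oner_eq0.
Qed.

Lemma imset_vecE (c : {ffun imset_index T -> bool}) S : vec c S = (c S)%:R.
Proof. by rewrite ffunE. Qed.

Lemma edge_disagree D E x y :
  is_face (CIM (R := R) G) (segment (vec (ess_imset g)) (vec (ess_imset h))) ->
  in_mec g D -> in_mec h E -> x \in A -> y \in A -> (x, y) \in D -> (x, y) \notin E.
Proof.
move=> face gD hE xA yA xyD; apply/negP=> xyE.
have oD := mec_orients skel_g gD; have oE := mec_orients skel_h hE.
have xy : G x y by case: oD => sub _; apply: sub.
have yx : G y x by rewrite (tree_sym treeG).
rewrite (mec_ess_imset treeG ess_g skel_g gD) (mec_ess_imset treeG ess_h skel_h hE) in face.
pose C := cut G x y.
have cross i j : i \in C -> j \notin C -> G i j -> ((i, j) \in D) = ((i, j) \in E).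
  by move=> iC jC ij; have [-> ->] := cut_cross treeG xy iC jC ij; rewrite xyD xyE.
have oU : orients G (mix C D E) by apply: orients_mix.
have oV : orients G (mix C E D) by apply: orients_mix => // i j *; rewrite cross.
have vertex F : orients G F -> exists F', [/\ is_dag F', skeleton F' =2 G
    & vec (char_imset F) = vec (char_imset F')].
  by move=> oF; exists F; split=> //; [apply: orients_dag oF | apply: orients_skeleton].
have sum : vec (char_imset (mix C D E)) + vec (char_imset (mix C E D)) =
    vec (char_imset D) + vec (char_imset E).
  apply/ffunP=> S; rewrite [LHS]ffunE [RHS]ffunE !imset_vecE.
  by case: (mix_imset treeG S oD oE cross) => -[-> ->] //; rewrite addrC.
have [t uE] := segment_affine (face_exchange face (vertex _ oU) (vertex _ oV) sum).
have coord i : i \in Delta G g h -> exists2 S, val S \in star_family G i &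
    char_imset D S != char_imset E S.
  rewrite inE (mec_ess_imset treeG ess_g skel_g gD) (mec_ess_imset treeG ess_h skel_h hE).
  by case/existsP=> S /andP[]; exists S.
have mixE S : (char_imset (mix C D E) S)%:R = (char_imset D S)%:R +
    t * ((char_imset E S)%:R - (char_imset D S)%:R) :> R.
  have affE (a b : imset_space R T) : (a + t *: (b - a)) S = a S + t * (b S - a S).
    by rewrite !ffunE.
  by rewrite -!imset_vecE -affE -uE.
(* Delta meets both sides of the edge. The mix equals [D] at the coordinate [S], which forces
   [t = 0], but equals [E] at [S'], where [t = 0] is impossible. *)
have [i /coord[S iS neS] iC] := span_cut treeG xA yA xy.
have [j /coord[S' jS neS'] jC] := span_cut treeG yA xA yx.
have {}jC := cut_disjoint treeG xy jC.
have := mixE S; have := mixE S'.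
have -> : char_imset (mix C D E) S = char_imset D S.
  by apply: (star_vpar treeG oU oD _ iS); apply: vpar_ext; rewrite parents_mix iC.
have -> : char_imset (mix C D E) S' = char_imset E S'.
  by apply: (star_vpar treeG oU oE _ jS); apply: vpar_ext; rewrite parents_mix (negPf jC).
have nz (b1 b2 : bool) : b1 != b2 -> (b2%:R - b1%:R : R) != 0.
  by case: b1; case: b2 => //= _; rewrite ?subr0 ?sub0r ?oppr_eq0 oner_eq0.
move=> tS' tS; have /eqP : t * ((char_imset E S)%:R - (char_imset D S)%:R) = 0 :> R.
  by apply: (@addrI _ (char_imset D S)%:R); rewrite addr0 -tS.
rewrite mulf_eq0 (negPf (nz _ _ neS)) orbF => /eqP t0.
by have := nz _ _ neS'; rewrite tS' t0 mul0r addr0 subrr eqxx.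
Qed.

(** Since [edge_disagree] holds for all members of the two classes, an arrow of one member of [g]
    inside the span is reversed in every member of [h]. The reversed arrow is therefore compelled,
    and by the same argument so is the original one. *)
Lemma edge_flip :
  is_edge (CIM (R := R) G) (segment (vec (ess_imset g)) (vec (ess_imset h))) ->
  essential_flip G g h.
Proof.
move=> [face /segment_dim1 neq].
have [D gD _] := ess_imsetP ess_g; have [E hE _] := ess_imsetP ess_h.
have oD := mec_orients skel_g gD; have oE := mec_orients skel_h hE.
have opposite x y : induced G A x y ->
    (pd_arrow g x y /\ pd_arrow h y x) \/ (pd_arrow g y x /\ pd_arrow h x y).
  case/and3P=> xA yA xy; have yx : G y x by rewrite (tree_sym treeG).
  rewrite !(mec_arrow gD) !(mec_arrow hE) /=.
  have noD F : in_mec g F -> ((x, y) \notin F) = ((y, x) \in F).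
    by move=> /(mec_orients skel_g)[_ tot]; rewrite (tot y x).
  have noE F : in_mec h F -> ((x, y) \notin F) = ((y, x) \in F).
    by move=> /(mec_orients skel_h)[_ tot]; rewrite (tot y x).
  have flipD i j : G i j -> (i, j) \notin compelled D -> exists2 F, in_mec g F & (j, i) \in F.
    move=> ij /(not_compelled treeG oD ij)[F [oF DF ji]]; exists F; last exact: ji.
    exact: (markov_mec gD (orients_dag treeG oF) DF).
  have flipE i j : G i j -> (i, j) \notin compelled E -> exists2 F, in_mec h F & (j, i) \in F.
    move=> ij /(not_compelled treeG oE ij)[F [oF EF ji]]; exists F; last exact: ji.
    exact: (markov_mec hE (orients_dag treeG oF) EF).
  have dis i j F H : i \in A -> j \in A -> in_mec g F -> in_mec h H ->
      (i, j) \in F -> (i, j) \in H -> False.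
    by move=> iA jA gF hH ij; apply/negP/(edge_disagree face gF hH iA jA ij).
  have agreeD F i j : i \in A -> j \in A -> G i j -> in_mec g F -> (i, j) \in F ->
      (j, i) \in compelled E.
    move=> iA jA ij gF ijF; apply: contraT => /flipE[|H hH ijH].
      by rewrite (tree_sym treeG).
    by case: (dis i j F H).
  have agreeE H i j : i \in A -> j \in A -> G i j -> in_mec h H -> (i, j) \in H ->
      (j, i) \in compelled D.
    move=> iA jA ij hH ijH; apply: contraT => /flipD[|F gF ijF].
      by rewrite (tree_sym treeG).
    by case: (dis i j F H).
  have sub : {subset compelled E <= E}.
    by move=> [i j]; apply: compelled_sub; apply: mec_dag hE.
  have [xyD|] := boolP ((x, y) \in D).
    have yxE := agreeD D x y xA yA xy gD xyD; left; split; last exact: yxE.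
    exact: (agreeE E y x yA xA yx hE (sub _ yxE)).
  rewrite (noD D gD) => yxD; have xyE := agreeD D y x yA xA yx gD yxD.
  right; split; last exact: xyE.
  exact: (agreeE E x y xA yA xy hE (sub _ xyE)).
split; last exact: opposite; first by split; split.
  move=> F H gF hH; apply/negP=> FH; apply: neq.
  have [_ /eqP gE] := andP gF; have [_ /eqP hE'] := andP hH.
  by rewrite -gE -hE' (markov_essential FH).
split; apply/setP=> -[x y]; rewrite !inE /=; apply/negP=> /and3P[xy xA yA].
  move: (xy); have [_ /eqP <-] := andP gD; rewrite inE /= => /and3P[sk nxy nyx].
  have Gxy : induced G A x y.
    apply/and3P; rewrite -(orients_skeleton treeG oD).
    by split; [exact: xA | exact: yA | exact: sk].
  by case: (opposite x y Gxy) => -[]; rewrite (mec_arrow gD) /= ?(negPf nxy) ?(negPf nyx).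
move: (xy); have [_ /eqP <-] := andP hE; rewrite inE /= => /and3P[sk nxy nyx].
have Gxy : induced G A x y.
  apply/and3P; rewrite -(orients_skeleton treeG oE).
  by split; [exact: xA | exact: yA | exact: sk].
by case: (opposite x y Gxy) => -[_]; rewrite (mec_arrow hE) /= ?(negPf nxy) ?(negPf nyx).
Qed.

(** The local functions of [flip_max] become a linear functional by [imset_functional], and among
    the vertices it is maximal only at the two given ones. *)
Lemma flip_edge : essential_flip G g h ->
  is_edge (CIM (R := R) G) (segment (vec (ess_imset g)) (vec (ess_imset h))).
Proof.
move=> [_ nequiv _ opposite].
have [D gD gE] := ess_imsetP ess_g; have [E hE hE'] := ess_imsetP ess_h.
have oD := mec_orients skel_g gD; have oE := mec_orients skel_h hE.
have DeltaE := Delta_vpar treeG oD oE gE hE'; rewrite gE hE'.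
have [d dDE] : exists i, vpar D i != vpar E i.
  apply/existsP; apply: contraT => /existsPn eqv.
  have /negP[] := nequiv D E gD hE; apply/(markov_vpar treeG oD oE) => i.
  by have := eqv i; rewrite negbK => /eqP.
have compD := compelled_sub (mec_dag gD); have compE := compelled_sub (mec_dag hE).
have opp x y : x \in A -> y \in A -> G x y ->
    (x, y) \in compelled D /\ (y, x) \in compelled E \/
    (y, x) \in compelled D /\ (x, y) \in compelled E.
  move=> xA yA xy; have := opposite x y; rewrite !(mec_arrow gD) !(mec_arrow hE).
  by apply; apply/and3P.
have fp : flip_pair G A D E.
  split=> //.
  - move=> i j iA jA ij; have ji : G j i by rewrite (tree_sym treeG).
    case: (opp i j iA jA ij) => -[/compD iD /compE jE].
      by rewrite (negPf (orients_antisym oD iD)) (negPf (orients_antisym oE jE)).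
    by rewrite iD jE.
  - move=> i j iA jA ij; have Gij : G i j by case: oD => sub _; apply: sub.
    case: (opp i j iA jA Gij) => -[cij _]; first exact: cij.
    have ji := compD _ _ cij; by rewrite (negPf (orients_antisym oD ij)) in ji.
  - move=> i j iA jA ij; have Gij : G i j by case: oE => sub _; apply: sub.
    case: (opp i j iA jA Gij) => -[_ cij]; last exact: cij.
    have ji := compE _ _ cij; by rewrite (negPf (orients_antisym oE ij)) in ji.
  - exact/subtreeP/(span_subtree treeG).
  - move=> i iA; apply/eqP; apply: contraNT iA => ne; apply: (subsetP (sub_tree_span treeG _)).
    by rewrite DeltaE inE.
  move=> i iA eqv; apply: (span_inner treeG _ iA); last by rewrite DeltaE inE eqv eqxx.
  by apply/set0Pn; exists d; rewrite DeltaE inE.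
have [phi [phiD phiE phi_max]] := flip_max R treeG fp (ex_intro _ d dDE).
have [f [c fE]] := imset_functional treeG phi.
split; last first.
  apply/segment_dim1 => /imset_vec_inj eqDE; case/eqP: dDE.
  by apply: (imset_vpar treeG oD oE) => S _; rewrite eqDE.
have vertex F : orients G F -> exists F', [/\ is_dag F', skeleton F' =2 G
    & vec (char_imset F) = vec (char_imset F')].
  by move=> oF; exists F; split=> //; [apply: orients_dag oF | apply: orients_skeleton].
apply: (@exposed_segment _ _ _ f c); try exact: vertex.
- by rewrite fE // phiD add0r.
- by rewrite fE // phiE add0r.
- move=> x [F [dF sF ->]]; have oF := dag_orients dF sF.
  by rewrite fE // gerDr; case: (phi_max F oF).
move=> x [F [dF sF ->]]; have oF := dag_orients dF sF.
rewrite fE // => /eqP; rewrite -subr_eq0 addrK => /eqP /(proj2 (phi_max F oF)).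
by case=> eqv; [left | right]; rewrite (vpar_imset treeG oF _ eqv).
Qed.

End Edges.

Theorem theorem2p7 (R : realFieldType) (p : nat) (G : rel 'I_p)
    (g h : pdgraph 'I_p)
    (hG : is_tree G)
    (hg : is_essential g) (hgG : pd_skeleton g =2 G)
    (hh : is_essential h) (hhG : pd_skeleton h =2 G) :
  is_edge (CIM (R := R) G)
    (segment (imset_vec R (ess_imset g)) (imset_vec R (ess_imset h)))
  <-> essential_flip G g h.
Proof. by split; [apply: edge_flip | apply: flip_edge]. Qed.
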